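(* Let $(\Omega,\mathcal F,\mathbb P)$ be a probability space, let $d,\mathfrak d,K,M\in\mathbb N$, $\varepsilon\in(0,\infty)$, $L,u\in\mathbb R$, $v\in(u,\infty)$, let $D\subseteq\mathbb R^d$ be a compact set with at least two elements, let $X_m\colon\Omega\to D$ and $Y_m\colon\Omega\to[u,v]$, $m\in\{1,\dots,M\}$, be functions such that $(X_m,Y_m)$, $m\in\{1,\dots,M\}$, are i.i.d. random variables, let $\delta\colon D\times D\to[0,\infty)$ be $\delta(x,y)=\sum_{i=1}^d|x_i-y_i|$, let $\varphi\colon D\to[u,v]$ satisfy $\mathbb P$-a.s. $\varphi(X_1)=\mathbb E[Y_1|X_1]$ and $|\varphi(x)-\varphi(y)|\le L\delta(x,y)$ for all $x,y\in D$, let $N\in\mathbb N\cap[\max\{2,\mathcal C_{(D,\delta),\varepsilon/(4L)}\},\infty)$, let $l\in\mathbb N\cap(N,\infty)$, let $\mathfrak l=(\mathfrak l_0,\dots,\mathfrak l_l)\in\mathbb N^{l+1}$ satisfy $\mathfrak l_0=d$, $\mathfrak l_1\ge 2dN$, $\mathfrak l_i\ge 2N-2i+3$ for all $i\in\mathbb N\cap[2,N]$, $\mathfrak l_j\ge 2$ for all $j\in\mathbb N\cap[N,l)$, $\mathfrak l_l=1$ and $\sum_{k=1}^l\mathfrak l_k(\mathfrak l_{k-1}+1)\le\mathfrak d$, let $R\in[\max\{1,L,\sup_{z\in D}\|z\|_\infty,2\sup_{z\in D}|\varphi(z)|\},\infty)$, let $B=[-R,R]^{\mathfrak d}$, let $\mathfrak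 E\colon B\times\Omega\to[0,\infty)$ be $\mathfrak E(\theta,\omega)=\frac1M\sum_{m=1}^M|\mathscr N^{\theta,\mathfrak l}_{u,v}(X_m(\omega))-Y_m(\omega)|^2$, let $\Theta_k\colon\Omega\to B$, $k\in\{1,\dots,K\}$, be i.i.d. random variables with $\Theta_1$ continuous uniformly distributed on $B$, and let $\Xi=\Theta_{k^*}$ with $k^*=\min\{k\in\{1,\dots,K\}\colon\mathfrak E(\Theta_k)=\min_{j\in\{1,\dots,K\}}\mathfrak E(\Theta_j)\}$. Then $$\mathbb P\Bigl(\int_D|\mathscr N^{\Xi,\mathfrak l}_{u,v}(x)-\varphi(x)|^2\,\mathbb P_{X_1}(dx)>\varepsilon^2\Bigr)\le\exp\Bigl(-K\min\Bigl\{1,\frac{\varepsilon^{2\mathfrak d}}{(16(v-u)l(\|\mathfrak l\|_\infty+1)^lR^{l+1})^{\mathfrak d}}\Bigr\}\Bigr)+2\exp\Bigl(\mathfrak d\ln\Bigl(\max\Bigl\{1,\frac{128l(\|\mathfrak l\|_\infty+1)^lR^{l+1}(v-u)}{\varepsilon^2}\Bigr\}\Bigr)-\frac{\varepsilon^4M}{32(v-u)^4}\Bigr).$$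
   Context: Covering number: for a metric space $(E,\delta)$ and $r\in[0,\infty]$, $\mathcal C_{(E,\delta),r}=\inf(\{n\in\mathbb N_0\colon\exists A\subseteq E \text{ with } |A|\le n \text{ and } \forall x\in E\ \exists a\in A\colon\delta(a,x)\le r\}\cup\{\infty\})$. Max norm: $\|\theta\|_\infty=\max_i|\theta_i|$ for $\theta\in\mathbb R^n$ (also applied to tuples of natural numbers). Clipped ReLU networks: for $r,s\in\mathbb N$, $k\in\mathbb N_0$, $\theta\in\mathbb R^{\mathfrak d}$ with $\mathfrak d\ge k+rs+r$, $\mathcal A^{\theta,k}_{r,s}\colon\mathbb R^s\to\mathbb R^r$ has $i$-th component $x\mapsto\sum_{j=1}^s\theta_{k+(i-1)s+j}x_j+\theta_{k+rs+i}$. For $u\in[-\infty,\infty)$, $v\in(u,\infty]$, $\mathfrak C_{u,v,n}$ applies $y\mapsto\max\{u,\min\{y,v\}\}$ componentwise on $\mathbb R^n$ and $\mathfrak R_n$ applies $y\mapsto\max\{y,0\}$ componentwise. For $L\in\mathbb N$, $l=(l_0,\dots,l_L)\in\mathbb N^{L+1}$, $\theta\in\mathbb R^{\mathfrak d}$ with $\mathfrak d\ge\sum_{k=1}^Ll_k(l_{k-1}+1)$, set $s_k=\sum_{j=1}^kl_j(l_{j-1}+1)$ and $\mathscr N^{\theta,l}_{u,v}=\mathfrak C_{u,v,l_L}\circ\mathcal A^{\theta,s_{L-1}}_{l_L,l_{L-1}}\circ\mathfrak R_{l_{L-1}}\circ\mathcal A^{\theta,s_{L-2}}_{l_{L-1},l_{L-2}}\circ\cdots\circ\mathfrak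 R_{l_1}\circ\mathcal A^{\theta,0}_{l_1,l_0}\colon\mathbb R^{l_0}\to\mathbb R^{l_L}$ (for $L=1$ just $\mathfrak C_{u,v,l_1}\circ\mathcal A^{\theta,0}_{l_1,l_0}$). *)

(* Defs.v *)
From HB Require Import structures.
From mathcomp Require Import all_boot all_order all_algebra.
From mathcomp Require Import all_classical all_reals all_analysis.

Set Implicit Arguments.
Unset Strict Implicit.
Unset Printing Implicit Defensive.

Import Order.TTheory GRing.Theory Num.Theory.
Import numFieldNormedType.Exports.

Local Open Scope classical_set_scope.
Local Open Scope ring_scope.

Section Defs.
Variable R : realType.

(* Points of R^n are row vectors 'rV[R]_n (this carries the usual     *)
(* topology, used for compactness).  Borel sets of R^n are obtained by *)
(* transport along the coordinate bijection to n.-tuple R, whose       *)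
(* sigma-algebra in MathComp-Analysis is the product (= Borel) one.    *)
Definition rv2t n (v : 'rV[R]_n) : n.-tuple R := [tuple v ord0 i | i < n].
Definition t2rv n (t : n.-tuple R) : 'rV[R]_n := \row_(i < n) tnth t i.

Definition borel_rV n (A : set 'rV[R]_n) : Prop :=
  exists2 B : set (n.-tuple R), measurable B & A = @rv2t n @^-1` B.

Definition l1dist n (x y : 'rV[R]_n) : R := \sum_(i < n) `|x ord0 i - y ord0 i|.

Definition maxnorm n (x : 'rV[R]_n) : R := \big[Num.max/0]_(i < n) `|x ord0 i|.

Definition covering_number (T : eqType) (E : set T) (delta : T -> T -> R) (r : \bar R)
  : \bar R :=
  ereal_inf [set (n%:R)%:E | n in
    [set n : nat | exists A : seq T,
        (size A <= n)%N /\ (forall a, a \in A -> E a) /\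
        (forall x, E x -> exists a, a \in A /\ ((delta a x)%:E <= r)%E)]].

(* Clipped ReLU networks.  Parameters theta in R^dd, accessed 1-based.  *)
(* Vectors of varying dimension between layers are sequences.          *)
Definition pget dd (theta : 'rV[R]_dd) (n : nat) : R :=
  match insub n.-1 with Some i => theta ord0 i | None => 0 end.

Definition affine dd (theta : 'rV[R]_dd) (k r s : nat) (x : seq R) : seq R :=
  [seq \sum_(j < s) pget theta (k + i * s + j.+1) * nth 0 x j
       + pget theta (k + r * s + i.+1) | i <- iota 0 r].

Definition relu (x : seq R) : seq R := [seq Num.max y 0 | y <- x].
Definition clip (u v : R) (x : seq R) : seq R :=
  [seq Num.max u (Num.min y v) | y <- x].

Definition sparam (lay : nat -> nat) (k : nat) : nat :=
  (\sum_(1 <= j < k.+1) lay j * (lay j.-1 + 1))%N.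

Fixpoint hidden dd (theta : 'rV[R]_dd) (lay : nat -> nat) (k : nat) (x : seq R)
  : seq R :=
  match k with
  | 0 => x
  | k'.+1 => relu (affine theta (sparam lay k') (lay k'.+1) (lay k')
                     (hidden theta lay k' x))
  end.

Definition network dd (theta : 'rV[R]_dd) (L : nat) (lay : nat -> nat) (u v : R)
  (x : seq R) : seq R :=
  clip u v (affine theta (sparam lay L.-1) (lay L) (lay L.-1)
              (hidden theta lay L.-1 x)).

(* the (unique, when l_L = 1) real output of the network on x in R^d *)
Definition network1 d dd (theta : 'rV[R]_dd) (L : nat) (lay : nat -> nat)
  (u v : R) (x : 'rV[R]_d) : R :=
  nth 0 (network theta L lay u v [seq x ord0 i | i <- enum 'I_d]) 0.

Definition arch_maxnorm (L : nat) (lay : nat -> nat) : nat :=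
  (\max_(i < L.+1) lay i)%N.

Section Prob.
Context (dT : measure_display) (T : measurableType dT) (P : probability T R).

Definition rv_measurable n (Z : T -> 'rV[R]_n) : Prop :=
  measurable_fun setT (@rv2t n \o Z).

Definition iid_family n (a b : nat) (Z : nat -> T -> 'rV[R]_n) : Prop :=
  [/\ (forall i, (a <= i <= b)%N -> rv_measurable (Z i)),
      (forall i j A, (a <= i <= b)%N -> (a <= j <= b)%N -> borel_rV A ->
          P (Z i @^-1` A) = P (Z j @^-1` A)) &
      (forall A : nat -> set 'rV[R]_n, (forall i, borel_rV (A i)) ->
          P (\bigcap_(i in [set i | (a <= i <= b)%N]) (Z i @^-1` A i)) =
          (\prod_(a <= i < b.+1) P (Z i @^-1` A i))%E)].

(* Z is continuous uniformly distributed on the cube [-Rb,Rb]^n: the law of Z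
   agrees with normalised n-dimensional Lebesgue measure restricted to the cube
   on all closed boxes prod_i [x_i, y_i]. *)
Definition box_side (a b Rb : R) : set R := `[a, b] `&` `[- Rb, Rb].

Definition uniform_on_cube n (Rb : R) (Z : T -> 'rV[R]_n) : Prop :=
  forall x y : 'rV[R]_n,
    P (Z @^-1` [set z | forall i, x ord0 i <= z ord0 i <= y ord0 i]) =
    (\prod_(i < n)
       (lebesgue_measure (box_side (x ord0 i) (y ord0 i) Rb) *
        ((2 * Rb)^-1)%:E))%E.

Definition is_cond_exp n (Y : T -> R) (X : T -> 'rV[R]_n) (g : 'rV[R]_n -> R)
  : Prop :=
  forall A, borel_rV A ->
    (\int[P]_(w in X @^-1` A) (Y w)%:E = \int[P]_(w in X @^-1` A) (g (X w))%:E)%E.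

End Prob.
End Defs.

(* Main.v *)
(* Write risk(th) = E|N^th(X_1) - phi(X_1)|^2 and R(th) = E|N^th(X_1) - Y_1|^2, with empirical
   version E_M(th).  Since phi(X_1) = E[Y_1|X_1], R - risk is a constant, so for every fixed
   th0 in the cube
     risk(Xi) <= risk(th0) + 2 sup_th |R(th) - E_M(th)| + min_k [E_M(Theta_k) - E_M(th0)].
   - th0 realizes x |-> max_k (phi(a_k) - L |x - a_k|_1) over a covering a_1, ..., a_N of D;
     it is within eps/2 of phi, so the first term is at most eps^2/4.
   - On the cube N^th(x) is Lipschitz in th for the max norm, with constant
     Lam = l (|lay|+1)^l Rb^l.  A grid of the cube and Hoeffding's inequality at its points
     bound the second term by eps^2/2 outside the second exponential.
   - The third term is at most eps^2/4 as soon as some Theta_k is within eps^2/(8 (v-u) Lam)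
     of th0; by independence this fails with probability at most the first exponential. *)
Require Import Defs.
From HB Require Import structures.
From mathcomp Require Import all_boot all_order all_algebra.
From mathcomp Require Import all_classical all_reals all_analysis.
From mathcomp Require Import measurable_realfun ring lra zify.

Import Order.TTheory GRing.Theory Num.Theory.
Import numFieldNormedType.Exports.

Local Open Scope classical_set_scope.
Local Open Scope ring_scope.

(** * Expectations of bounded random variables *)

Section BoundedMeasurable.
Context {R : realType} {dT : measure_display} {T : measurableType dT}.
Implicit Types f g : T -> R.

(** The hypotheses speak only of events: independence is a product formula for preimages of Borel
    sets, and [is_cond_exp] equates integrals over events {X_1 in A}. [Ex_orthogonal] is the passage
    from events to functions. It serves twice: for the cross term whose vanishing makes R - risk
    constant, and for the factorization of the exponential moments in Hoeffding's inequality. No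
    independence between the [Theta k] and the sample is assumed, so Xi may depend on both in any
    way. Hence the deviation is controlled on the whole cube, and the two bad events are combined by
    a union bound only. The network uses max(m, h) = relu(m - h) + relu(h) - relu(-h) and absorbs
    one piece per layer, which explains N < l and the decreasing widths. Constants: 16 is 8, from 2
    (v-u) Lam r = eps^2/4, times the 2 in the side 2 Rb of the cube; the 32 of the exponent comes
    from 2 (eps^2/8)^2; 128 is 4 times 32, the latter from a mesh that moves each risk by at most
    eps^2/16. *)

Definition bmeas f := measurable_fun setT f /\ exists C : R, forall x, `|f x| <= C.

Lemma bmeas_cst c : bmeas (fun=> c).
Proof. by split; [exact: measurable_cst|exists `|c|]. Qed.

Lemma bmeasD f g : bmeas f -> bmeas g -> bmeas (fun x => f x + g x).
Proof.
move=> [mf [C fC]] [mg [C' gC]]; split; first exact: measurable_funD.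
by exists (C + C') => x; rewrite (le_trans (ler_normD _ _))// lerD.
Qed.

Lemma bmeasM f g : bmeas f -> bmeas g -> bmeas (fun x => f x * g x).
Proof.
move=> [mf [C fC]] [mg [C' gC]]; split; first exact: measurable_funM.
by exists (C * C') => x; rewrite normrM ler_pM.
Qed.

Lemma bmeasZ c f : bmeas f -> bmeas (fun x => c * f x).
Proof. by move=> hf; apply: bmeasM => //; exact: bmeas_cst. Qed.

Lemma bmeasB f g : bmeas f -> bmeas g -> bmeas (fun x => f x - g x).
Proof.
move=> [mf [C fC]] [mg [C' gC]]; split; first exact: measurable_funB.
by exists (C + C') => x; rewrite (le_trans (ler_normB _ _))// lerD.
Qed.

Lemma bmeas_itv (f : T -> R) (a b : R) : measurable_fun setT f ->
  (forall w, a <= f w <= b) -> bmeas f.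
Proof.
move=> mf hf; split => //; exists (`|a| + `|b|) => w; have /andP[ha hb] := hf w.
by rewrite ler_norml; have := ler_norm b; have := ler_norm (- a); rewrite normrN;
  have := normr_ge0 a; have := normr_ge0 b; lra.
Qed.

Lemma bmeas_sqr (f : T -> R) : bmeas f -> bmeas (fun w => f w ^+ 2).
Proof. by move=> hf; under eq_fun do rewrite expr2; exact: bmeasM. Qed.

Lemma bmeas_sum (I : Type) (r : seq I) (F : I -> T -> R) :
  (forall i, bmeas (F i)) -> bmeas (fun x => \sum_(i <- r) F i x).
Proof.
move=> hF; elim: r => [|i r ih].
  by under eq_fun do rewrite big_nil; exact: bmeas_cst.
by under eq_fun do rewrite big_cons; exact: bmeasD.
Qed.

Lemma bmeas_prod (I : Type) (r : seq I) (F : I -> T -> R) :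
  (forall i, bmeas (F i)) -> bmeas (fun x => \prod_(i <- r) F i x).
Proof.
move=> hF; elim: r => [|i r ih].
  by under eq_fun do rewrite big_nil; exact: bmeas_cst.
by under eq_fun do rewrite big_cons; exact: bmeasM.
Qed.

Lemma bmeas_expR f : bmeas f -> bmeas (fun x => expR (f x)).
Proof.
move=> [mf [C fC]]; split; first by apply: measurableT_comp.
by exists (expR C) => x; rewrite ger0_norm ?expR_ge0// ler_expR (le_trans (ler_norm _)).
Qed.

Lemma bmeas_indic (A : set T) : measurable A -> bmeas (\1_A).
Proof.
move=> mA; split; first exact: measurable_indic.
by exists 1 => x; rewrite indicE; case: (_ \in _); rewrite ?normr0 ?normr1.
Qed.

Lemma bmeas_preim f (B : set R) : bmeas f -> measurable B -> measurable (f @^-1` B).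
Proof. by move=> [mf _] mB; rewrite -[_ @^-1` _]setTI; exact: mf. Qed.

Context (P : probability T R).

(** Real valued, so that estimates are plain real arithmetic; for [bmeas] functions the underlying
    integral is finite and nothing is lost. *)
Definition Ex f : R := \int[P]_x f x.

Lemma bmeas_integrable f : bmeas f -> P.-integrable setT (EFin \o f).
Proof.
move=> [mf [C fC]]; apply: measurable_bounded_integrable => //.
  exact: (le_lt_trans (probability_le1 P measurableT) (ltry 1)).
exists C; split; first exact: num_real.
by move=> x Cx y _ /=; rewrite (le_trans (fC y))// ltW.
Qed.

Lemma ExE f : bmeas f -> (Ex f)%:E = (\int[P]_x (f x)%:E)%E.
Proof.
by move=> hf; rewrite /Ex /Rintegral fineK//; apply: integrable_fin_num => //;
  exact: bmeas_integrable.
Qed.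

Lemma eq_Ex f g : (forall x, f x = g x) -> Ex f = Ex g.
Proof. by move=> fg; apply: eq_Rintegral => x _. Qed.

Lemma Ex_cst c : Ex (fun=> c) = c.
Proof. by rewrite /Ex Rintegral_cst//= probability_setT mulr1. Qed.

Lemma ExD f g : bmeas f -> bmeas g -> Ex (fun x => f x + g x) = Ex f + Ex g.
Proof. by move=> hf hg; apply: RintegralD => //; exact: bmeas_integrable. Qed.

Lemma ExB f g : bmeas f -> bmeas g -> Ex (fun x => f x - g x) = Ex f - Ex g.
Proof. by move=> hf hg; apply: RintegralB => //; exact: bmeas_integrable. Qed.

Lemma ExZ c f : bmeas f -> Ex (fun x => c * f x) = c * Ex f.
Proof. by move=> hf; apply: RintegralZl => //; exact: bmeas_integrable. Qed.

Lemma Ex_sum (I : Type) (r : seq I) (F : I -> T -> R) :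
  (forall i, bmeas (F i)) -> Ex (fun x => \sum_(i <- r) F i x) = \sum_(i <- r) Ex (F i).
Proof.
move=> hF; elim: r => [|i r ih].
  by under eq_Ex do rewrite big_nil; rewrite big_nil Ex_cst.
under eq_Ex do rewrite big_cons; rewrite big_cons ExD ?ih//; exact: bmeas_sum.
Qed.

Lemma le_Ex f g : bmeas f -> bmeas g -> (forall x, f x <= g x) -> Ex f <= Ex g.
Proof. by move=> hf hg fg; apply: le_Rintegral => //; exact: bmeas_integrable. Qed.

Lemma Ex_norm_le f c : bmeas f -> (forall x, `|f x| <= c) -> `|Ex f| <= c.
Proof.
move=> hf fc; rewrite ler_norml.
suff : Ex (fun=> - c) <= Ex f <= Ex (fun=> c) by rewrite !Ex_cst.
by apply/andP; split; apply: le_Ex => //; try exact: bmeas_cst;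
  move=> x; have := fc x; rewrite ler_norml => /andP[].
Qed.

Lemma Ex_setE (A : set T) f : Ex (fun x => \1_A x * f x) = \int[P]_(x in A) f x.
Proof.
rewrite /Ex (Rintegral_mkcond _ A); apply: eq_Rintegral => x _.
by rewrite indicE patchE; case: (x \in A); rewrite ?mul1r ?mul0r.
Qed.

Lemma Ex_indic (A : set T) : measurable A -> (Ex (\1_A))%:E = P A.
Proof.
move=> mA; rewrite ExE; last exact: bmeas_indic.
by rewrite integral_indic// setIT.
Qed.

Lemma markov_Ex f a : bmeas f -> (forall x, 0 <= f x) -> 0 < a ->
  (P [set x | a <= f x]%R <= (Ex f / a)%:E)%E.
Proof.
move=> hf f0 a0.
have mA : measurable [set x | a <= f x].
  have -> : [set x | a <= f x] = f @^-1` `[a, +oo[.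
    by apply/seteqP; split => x /=; rewrite in_itv/= andbT.
  exact: bmeas_preim.
rewrite -Ex_indic// lee_fin mulrC -ExZ//; apply: le_Ex.
- exact: bmeas_indic.
- exact: bmeasZ.
move=> x; rewrite indicE; case: (boolP (a <= f x)) => h; last first.
  by rewrite memNset ?mulr_ge0// ?invr_ge0 ?ltW//; exact/negP.
rewrite mem_set//.
by rewrite -(mulVf (lt0r_neq0 a0)) ler_pM2l// invr_gt0.
Qed.

(* g is uniformly approximated by finite combinations of indicators of its level sets *)
Lemma Ex_orthogonal (H g : T -> R) : bmeas H -> bmeas g ->
  (forall B, measurable B -> Ex (fun x => \1_(g @^-1` B) x * H x) = 0) ->
  Ex (fun x => g x * H x) = 0.
Proof.
move=> hH hg orth.
have [_ [C gC]] := hg; have [_ [CH HC]] := hH.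
have step n : (0 < n)%N -> `|Ex (fun x => g x * H x)| <= CH / n%:R.
  move=> n0; have n0R : 0 < n%:R :> R by rewrite ltr0n.
  (* The N cells [a j, a j.+1) of width 1/n start at -C and reach beyond C, so every value of g, the
     value C included, lies in exactly one of them. *)
  pose N := (Num.truncn (2 * C * n%:R)).+1.
  pose a (j : nat) := - C + j%:R / n%:R.
  pose B (j : nat) := [set` `[a j, a j.+1[] : set R.
  pose s x := \sum_(0 <= j < N) a j * \1_(g @^-1` B j) x.
  have mB j : measurable (g @^-1` B j) by apply: bmeas_preim => //; exact: measurable_itv.
  have hs : bmeas s.
    by apply: bmeas_sum => j; apply: bmeasZ; apply: bmeas_indic.
  have gs x : `|g x - s x| <= n%:R^-1.
    have /andP[Cg gC'] : - C <= g x <= C by rewrite -ler_norml.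
    have p0 : 0 <= (g x + C) * n%:R by rewrite mulr_ge0// ?ler0n// -lerBlDr sub0r.
    have := truncn_itv p0; set j := Num.truncn _ => /andP[j1 j2].
    have jN : (j < N)%N.
      rewrite ltnS; apply: le_truncn; rewrite ler_wpM2r ?ler0n//; lra.
    have gB : B j (g x).
      rewrite /B /a /= in_itv/=; apply/andP; split.
        by rewrite addrC lerBlDr ler_pdivrMr.
      by rewrite addrC ltrBrDr ltr_pdivlMr.
    have -> : s x = a j.
      rewrite /s (bigD1_seq j) ?iota_uniq ?mem_index_iota//=.
      rewrite indicE mem_set// mulr1 big1 ?addr0// => i ij.
      rewrite indicE memNset ?mulr0//= => gBi.
      move: gB gBi; rewrite /B/= !in_itv/= /a => /andP[h1 h2] /andP[h3 h4].
      have H1 : i%:R / n%:R < j.+1%:R / n%:R :> R by lra.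
      have H2 : j%:R / n%:R < i.+1%:R / n%:R :> R by lra.
      move: H1 H2; rewrite !ltr_pM2r ?invr_gt0// !ltr_nat !ltnS => ij1 ij2.
      by move: ij; rewrite eqn_leq ij1 ij2.
    move: gB; rewrite /B/= in_itv/= /a -natr1 mulrDl mul1r => /andP[h1 h2].
    by rewrite ger0_norm; lra.
  (* The step function s is a combination of level-set indicators of g, hence already orthogonal to
     H, and may be subtracted from g for free. *)
  have -> : Ex (fun x => g x * H x) = Ex (fun x => (g x - s x) * H x).
    under [RHS]eq_Ex do rewrite mulrBl.
    rewrite ExB; [|exact: bmeasM|exact: bmeasM].
    suff -> : Ex (fun x => s x * H x) = 0 by rewrite subr0.
    under eq_Ex do rewrite /s mulr_suml.
    rewrite Ex_sum; last first.
      by move=> i; apply: bmeasM => //; apply: bmeasZ; apply: bmeas_indic.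
    rewrite big1// => i _; under eq_Ex do rewrite -mulrA.
    rewrite ExZ; last by apply: bmeasM => //; exact: bmeas_indic.
    by rewrite orth ?mulr0//; exact: measurable_itv.
  apply: Ex_norm_le; first by apply: bmeasM => //; exact: bmeasB.
  by move=> x; rewrite normrM mulrC ler_pM.
apply/eqP; rewrite -normr_eq0 eq_le normr_ge0 andbT.
apply/ler_addgt0Pr => e e0; rewrite add0r.
(* Any n above CH / e brings the bound below e; if CH <= 0, already n = 1 suffices. *)
have [CH0|CH0] := leP CH 0.
  have := step 1%N isT; rewrite divr1 => h; lra.
have n0 : (0 < (Num.truncn (CH / e)).+1)%N by [].
apply: (le_trans (step _ n0)).
rewrite ler_pdivrMr ?ltr0n// mulrC -ler_pdivrMr// ltW// truncnS_gt//.
Qed.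

End BoundedMeasurable.

(** * Hoeffding's inequality *)

Section Hoeffding.
Context {R : realType}.

(** Mean value theorem on [0, h]. Derivatives are asked only on the nonnegative half-line, where
    [hoeffding_two_point] differentiates a logarithm. *)
Lemma le_of_derive_ge0 (f df : R -> R) : (forall x : R, 0 <= x -> is_derive x 1 f (df x)) ->
  (forall x, 0 <= x -> 0 <= df x) -> forall h, 0 <= h -> f 0 <= f h.
Proof.
move=> hd hp h h0; rewrite -subr_ge0.
have [||c] := @MVT_segment R f df 0 h h0.
- by move=> x; rewrite in_itv/= => /andP[/ltW x0 _]; exact: hd.
- apply: derivable_within_continuous => x; rewrite in_itv/= => /andP[x0 _].
  by have := hd _ x0 => /@ex_derive.
by rewrite in_itv/= => /andP[c0 _] ->; rewrite mulr_ge0 ?hp// subr0.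
Qed.

(** Hoeffding's lemma for a Bernoulli variable of parameter p. The logarithm of the left side has
    derivative [q], the success probability of the tilted law, with q(0) = p and q' = q (1 - q) <=
    1/4; two integrations from 0 give p h + h^2/8. *)
Lemma hoeffding_two_point (p h : R) : 0 <= p <= 1 -> 0 <= h ->
  1 - p + p * expR h <= expR (p * h + h ^+ 2 / 8).
Proof.
move=> /andP[p0 p1] h0.
pose E (x : R) : R := 1 - p + p * expR x.
have E0 (x : R) : 0 <= x -> 0 < E x.
  move=> x0; rewrite /E; have := expR_gt0 x; have : 1 <= expR x by have := expR_ge1Dx x; lra.
  nra.
have dE (x : R) : is_derive x 1 E (p * expR x).
  by apply: is_derive_eq; rewrite /GRing.scale/=; ring.
(* Written with exp(- ln E) instead of a quotient, so that the product and chain rules give q' = q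
   (1 - q) directly. *)
pose q (x : R) : R := p * (expR x * expR (- ln (E x))).
have qE (x : R) : 0 <= x -> q x = p * expR x / E x.
  by move=> x0; rewrite /q expRN lnK ?posrE ?E0// mulrA.
have dlnE (x : R) : 0 <= x -> is_derive x 1 (@ln R \o E) (q x).
  move=> x0; have hl := is_derive1_ln (E0 _ x0); apply: is_derive_eq.
  by rewrite qE// mulrC.
have dq (x : R) : 0 <= x -> is_derive x 1 q (q x * (1 - q x)).
  move=> x0; have hl := dlnE _ x0.
  have h1 : is_derive x 1 (expR \o (- (@ln R \o E))) (expR (- ln (E x)) * - q x).
    exact: is_derive1_comp.
  have h2 := is_deriveM (is_derive_expR x) h1.
  have h3 := is_deriveZ p h2.
  apply: is_derive_eq.
  by rewrite /GRing.scale/= /q; ring.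
have qle (x : R) : 0 <= x -> q x <= p + x / 4.
  move=> x0.
  have := @le_of_derive_ge0 (fun x => p + x / 4 - q x) (fun x => 4^-1 - q x * (1 - q x)) _ _ x x0.
  have -> : q 0 = p by rewrite qE// /E expR0; field; lra.
  rewrite mul0r addr0 subrr subr_ge0; apply.
    move=> y y0; have hq := dq _ y0.
    by apply: is_derive_eq; rewrite /GRing.scale/=; ring.
  by move=> y y0; have -> : 4^-1 - q y * (1 - q y) = (q y - 2^-1) ^+ 2; [field|exact: sqr_ge0].
rewrite -[X in X <= _]lnK ?posrE; last exact: (E0 h).
rewrite ler_expR -subr_ge0.
have := @le_of_derive_ge0 (fun x => p * x + x ^+ 2 / 8 - ln (E x)) (fun x => p + x / 4 - q x) _ _ h h0.
rewrite [E 0]/E expR0 mulr1 subrK ln1 mulr0 expr0n/= mul0r addr0 subr0; apply.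
- move=> x x0; have hl := dlnE _ x0.
  by apply: is_derive_eq; rewrite /GRing.scale/=; field.
- by move=> x x0; rewrite subr_ge0 qle.
Qed.

(** Convexity of exp from 1 + y <= exp y alone: in the combination of [e1] and [e2] with weights 1 -
    t and t the terms linear in h cancel. *)
Lemma expR_chord (t h : R) : 0 <= t <= 1 -> expR (t * h) <= 1 - t + t * expR h.
Proof.
move=> /andP[t0 t1].
have e1 : expR (t * h) * (1 - t * h) <= 1.
  rewrite -[leRHS](expRxMexpNx_1 (t * h)) ler_pM2l ?expR_gt0//.
  by rewrite -mulNr; have := expR_ge1Dx (- t * h); lra.
have e2 : expR (t * h) * (1 + (1 - t) * h) <= expR h.
  have -> : expR h = expR (t * h) * expR ((1 - t) * h).
    by rewrite -expRD; congr expR; ring.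
  by rewrite ler_pM2l ?expR_gt0// expR_ge1Dx.
nra.
Qed.

Context {dT : measure_display} {T : measurableType dT} (P : probability T R).

(** Only full products of M indicators are compared; smaller subfamilies are covered by taking [B i]
    to be the whole line. The form with expectations is the one that extends from indicators to
    functions. *)
Definition indep_family (M : nat) (W : nat -> T -> R) :=
  forall B : nat -> set R, (forall i, measurable (B i)) ->
  Ex P (fun x => \prod_(i < M) \1_(W i @^-1` B i) x) =
  \prod_(i < M) Ex P (\1_(W i @^-1` B i)).

Lemma indep_family_comp M (W : nat -> T -> R) (f : R -> R) :
  measurable_fun setT f -> indep_family M W -> indep_family M (fun i x => f (W i x)).
Proof.
move=> mf hW B mB; apply: (hW (fun i => f @^-1` B i)) => i.
by rewrite -[_ @^-1` _]setTI; exact: mf.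
Qed.

(* The factors [1_{W_i in B_i}] are replaced by [W_i] one index at a time. *)
Lemma Ex_prod_indep (M : nat) (W : nat -> T -> R) : (forall i, bmeas (W i)) ->
  indep_family M W ->
  Ex P (fun x => \prod_(i < M) W i x) = \prod_(i < M) Ex P (W i).
Proof.
move=> hW hI.
pose V (j : nat) (B : nat -> set R) (i : nat) (x : T) : R :=
  if (i < j)%N then W i x else \1_(W i @^-1` B i) x.
have hV j B i : (forall i, measurable (B i)) -> bmeas (V j B i).
  by move=> mB; rewrite /V; case: (i < j)%N => //; apply: bmeas_indic; exact: bmeas_preim.
suff H j : (j <= M)%N -> forall B, (forall i, measurable (B i)) ->
    Ex P (fun x => \prod_(i < M) V j B i x) = \prod_(i < M) Ex P (V j B i).
  (* For j = M no factor is an indicator any more, so the choice of sets is arbitrary. *)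
  have := H M (leqnn _) (fun=> set0) (fun=> measurable0).
  rewrite (eq_Ex P _ (fun x => \prod_(i < M) W i x)); last first.
    by move=> x; apply: eq_bigr => i _; rewrite /V ltn_ord.
  by move=> ->; apply: eq_bigr => i _; apply: eq_Ex => x; rewrite /V ltn_ord.
elim: j => [_ B mB|j ih jM B mB]; first exact: (hI B mB).
pose jo := Ordinal jM.
pose G x := \prod_(i < M | i != jo) V j B i x.
pose c := \prod_(i < M | i != jo) Ex P (V j B i).
have hG : bmeas G.
  by rewrite /G; under eq_fun do rewrite -big_filter; apply: bmeas_prod => i; exact: hV.
have VS i x : i != jo -> V j.+1 B i x = V j B i x.
  move=> ij; rewrite /V ltnS leq_eqVlt.
  by have /negbTE -> : nat_of_ord i != j by apply: contra ij => /eqP ij; apply/eqP/val_inj.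
(* The j-th event is free in the induction hypothesis. Letting it vary shows that G - c integrates
   to 0 over every level set of [W j], which is what [Ex_orthogonal] asks. *)
have key C : measurable C ->
    Ex P (fun x => \1_(W j @^-1` C) x * G x) = Ex P (\1_(W j @^-1` C)) * c.
  move=> mC; pose B' i := if i == j then C else B i.
  have mB' i : measurable (B' i) by rewrite /B'; case: ifP.
  have VB' i x : i != jo -> V j B' i x = V j B i x.
    move=> ij; rewrite /V /B'.
    by have /negbTE -> : nat_of_ord i != j by apply: contra ij => /eqP ij; apply/eqP/val_inj.
  have Vj x : V j B' j x = \1_(W j @^-1` C) x by rewrite /V ltnn /B' eqxx.
  have := ih (ltnW jM) B' mB'.
  rewrite [RHS](bigD1 jo)//= (eq_Ex P _ _ Vj).
  have -> : \prod_(i < M | i != jo) Ex P (V j B' i) = c.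
    by apply: eq_bigr => i ij; apply: eq_Ex => x; rewrite VB'.
  move=> <-; apply: eq_Ex => x; rewrite (bigD1 jo)//= Vj; congr (_ * _).
  by apply: eq_bigr => i ij; rewrite VB'.
have orth : Ex P (fun x => W j x * (G x - c)) = 0.
  apply: Ex_orthogonal => //; first by apply: bmeasB => //; exact: bmeas_cst.
  move=> C mC; under eq_Ex do rewrite mulrBr [X in _ - X]mulrC.
  have hi : bmeas (\1_(W j @^-1` C) : T -> R) by apply: bmeas_indic; exact: bmeas_preim.
  rewrite ExB; [|exact: bmeasM|exact: bmeasZ].
  by rewrite ExZ// key// mulrC subrr.
rewrite (bigD1 jo)//=.
have Vj x : V j.+1 B j x = W j x by rewrite /V ltnSn.
rewrite (eq_Ex P _ _ Vj).
have -> : \prod_(i < M | i != jo) Ex P (V j.+1 B i) = c.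
  by apply: eq_bigr => i ij; apply: eq_Ex => x; rewrite VS.
have -> : Ex P (fun x => \prod_(i < M) V j.+1 B i x) = Ex P (fun x => W j x * G x).
  apply: eq_Ex => x; rewrite (bigD1 jo)//= Vj; congr (_ * _).
  by apply: eq_bigr => i ij; rewrite VS.
apply/eqP; rewrite -subr_eq0 -orth; apply/eqP.
under [RHS]eq_Ex do rewrite mulrBr [X in _ - X]mulrC.
rewrite ExB; [|exact: bmeasM|exact: bmeasZ].
by rewrite ExZ// [c * _]mulrC.
Qed.

End Hoeffding.
Section HoeffdingInequality.
Context {R : realType} {dT : measure_display} {T : measurableType dT} (P : probability T R).
Variables (M : nat) (W : nat -> T -> R) (c mu eta : R).
Hypotheses (hM : (0 < M)%N) (c0 : 0 < c) (eta0 : 0 < eta).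
Hypotheses (mW : forall i, measurable_fun setT (W i)).
Hypotheses (hW : forall i x, 0 <= W i x <= c) (hmu : forall i, Ex P (W i) = mu).

Let bW i : bmeas (W i).
Proof.
split=> //; exists c => x; have /andP[h1 h2] := hW i x; by rewrite ger0_norm.
Qed.

(** As W i / c lies in [0, 1], the chord bound dominates the exponential by an affine function of W
    i. Its mean depends on mu only: it is the exponential moment of the law on {0, c} with mean
    mu. *)
Lemma hoeffding_mgf i lam : 0 <= lam ->
  Ex P (fun x => expR (lam * (W i x - mu))) <= expR (lam ^+ 2 * c ^+ 2 / 8).
Proof.
move=> lam0.
have hp : 0 <= mu / c <= 1.
  rewrite ler_pdivrMr// mul1r divr_ge0 ?(ltW c0)//=; last first.
    rewrite -(hmu i) -(Ex_cst P 0); apply: le_Ex => //; first exact: bmeas_cst.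
    by move=> x; have /andP[] := hW i x.
  rewrite -(hmu i) -(Ex_cst P c); apply: le_Ex => //; first exact: bmeas_cst.
  by move=> x; have /andP[] := hW i x.
have := hoeffding_two_point _ (lam * c) hp (mulr_ge0 lam0 (ltW c0)).
set e := expR (lam * c) => two.
have -> : Ex P (fun x => expR (lam * (W i x - mu)))
   = expR (- (lam * mu)) * Ex P (fun x => expR (lam * W i x)).
  rewrite -ExZ; last by apply: bmeas_expR; exact: bmeasZ.
  by apply: eq_Ex => x; rewrite -expRD; congr expR; ring.
have : Ex P (fun x => expR (lam * W i x)) <= 1 - mu / c + mu / c * e.
  have -> : 1 - mu / c + mu / c * e = Ex P (fun x => 1 + (e - 1) / c * W i x).
    rewrite ExD; [|exact: bmeas_cst|exact: bmeasZ].
    by rewrite Ex_cst ExZ// hmu; field; rewrite gt_eqF.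
  apply: le_Ex.
  - by apply: bmeas_expR; exact: bmeasZ.
  - by apply: bmeasD; [exact: bmeas_cst|exact: bmeasZ].
  move=> x; have -> : lam * W i x = W i x / c * (lam * c) by field; rewrite gt_eqF.
  have -> : 1 + (e - 1) / c * W i x = 1 - W i x / c + W i x / c * e.
    by field; rewrite gt_eqF.
  apply: expR_chord; have /andP[h1 h2] := hW i x.
  by rewrite divr_ge0 ?(ltW c0)//= ler_pdivrMr// mul1r.
move=> /le_trans /(_ two) h.
rewrite -[leRHS](_ : expR (- (lam * mu)) * expR (mu / c * (lam * c) + (lam * c) ^+ 2 / 8) = _).
  by rewrite ler_pM2l// expR_gt0.
by rewrite -expRD; congr expR; field; rewrite gt_eqF.
Qed.

(** Chernoff's method: Markov's inequality for exp(lam M (average - mu)), whose expectation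
    factorizes by independence. *)
Lemma hoeffding_upper : indep_family P M W ->
  (P [set x | eta <= M%:R^-1 * \sum_(i < M) W i x - mu]%R
   <= (expR (- (2 * eta ^+ 2 * M%:R / c ^+ 2)))%:E)%E.
Proof.
move=> hI.
have M0 : 0 < M%:R :> R by rewrite ltr0n.
(* The minimizer of lam^2 c^2/8 - lam eta. *)
pose lam := 4 * eta / c ^+ 2.
have lam0 : 0 < lam by rewrite divr_gt0 ?mulr_gt0 ?exprn_gt0.
pose F i x := expR (lam * (W i x - mu)).
have bF i : bmeas (F i).
  by apply: bmeas_expR; apply: bmeasZ; apply: bmeasB => //; exact: bmeas_cst.
have -> : [set x | eta <= M%:R^-1 * \sum_(i < M) W i x - mu]
   = [set x | expR (lam * (M%:R * eta)) <= \prod_(i < M) F i x].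
  have S x : \sum_(i < M) lam * (W i x - mu) = lam * (M%:R * (M%:R^-1 * \sum_(i < M) W i x - mu)).
    rewrite -mulr_sumr sumrB sumr_const card_ord -[mu *+ M]mulr_natl.
    by field; rewrite lt0r_neq0.
  by apply/seteqP; split=> x /=; rewrite -expR_sum ler_expR S !ler_pM2l.
apply: le_trans.
  apply: markov_Ex.
  - by apply: (bmeas_prod _ _ (fun (i : 'I_M) x => F i x)).
  - by move=> x; apply: prodr_ge0 => i _; exact: expR_ge0.
  - exact: expR_gt0.
rewrite lee_fin ler_pdivrMr ?expR_gt0//.
rewrite (@Ex_prod_indep _ _ _ P M F)//; last first.
  apply: (indep_family_comp P M W (fun y => expR (lam * (y - mu)))) => //.
  apply: measurableT_comp => //; apply: measurable_funM => //.
  exact: measurable_funB.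
apply: (@le_trans _ _ (\prod_(i < M) expR (lam ^+ 2 * c ^+ 2 / 8))).
  apply: ler_prod => i _; rewrite hoeffding_mgf ?(ltW lam0)// andbT.
  by rewrite -(Ex_cst P 0); apply: le_Ex => //; [exact: bmeas_cst|move=> x; exact: expR_ge0].
rewrite prodr_const card_ord -expRM_natl -expRD ler_expR le_eqVlt; apply/orP; left.
by apply/eqP; rewrite /lam; field; rewrite gt_eqF.
Qed.

End HoeffdingInequality.

(** The lower tail of W is the upper tail of c - W, which has mean c - mu and again takes values in
    [0, c]. *)
Lemma hoeffding {R : realType} {dT : measure_display} {T : measurableType dT}
  (P : probability T R) (M : nat) (W : nat -> T -> R) (c mu eta : R) :
  (0 < M)%N -> 0 < c -> 0 < eta -> (forall i, measurable_fun setT (W i)) ->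
  (forall i x, 0 <= W i x <= c) -> (forall i, Ex P (W i) = mu) -> indep_family P M W ->
  (P [set x | eta <= `|M%:R^-1 * \sum_(i < M) W i x - mu|]%R
   <= (2 * expR (- (2 * eta ^+ 2 * M%:R / c ^+ 2)))%:E)%E.
Proof.
move=> hM c0 eta0 mW hW hmu hI.
have M0 : 0 < M%:R :> R by rewrite ltr0n.
have bW i : bmeas (W i).
  by split=> //; exists c => x; have /andP[h1 h2] := hW i x; rewrite ger0_norm.
pose W' i x := c - W i x.
have e1 : [set x | eta <= `|M%:R^-1 * \sum_(i < M) W i x - mu|] =
   [set x | eta <= M%:R^-1 * \sum_(i < M) W i x - mu] `|`
   [set x | eta <= M%:R^-1 * \sum_(i < M) W' i x - (c - mu)].
  have e2 x : M%:R^-1 * \sum_(i < M) W' i x - (c - mu) = - (M%:R^-1 * \sum_(i < M) W i x - mu).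
    by rewrite sumrB sumr_const card_ord -mulr_natl; field; rewrite lt0r_neq0.
  by apply/seteqP; split=> x /=; rewrite e2 ler_normr => /orP.
have mlevel (f : T -> R) : measurable_fun setT f -> measurable [set x | eta <= f x].
  move=> mf; rewrite -[X in measurable X]setTI.
  have -> : [set x | eta <= f x] = f @^-1` `[eta, +oo[.
    by apply/seteqP; split => x /=; rewrite in_itv/= andbT.
  by apply: mf => //; exact: measurable_itv.
have mavg (V : nat -> T -> R) m : (forall i, measurable_fun setT (V i)) ->
    measurable_fun setT (fun x => M%:R^-1 * \sum_(i < M) V i x - m).
  move=> mV; apply: measurable_funB => //; apply: measurable_funM => //.
  exact: measurable_sum.
have mW' i : measurable_fun setT (W' i) by exact: measurable_funB.
rewrite e1; apply: (le_trans (measureU2 _ _ _)).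
- by apply: mlevel; exact: mavg.
- by apply: mlevel; exact: mavg.
rewrite mulrDl mul1r EFinD; apply: leeD.
  exact: hoeffding_upper.
apply: hoeffding_upper => //.
- by move=> i x; have /andP[h1 h2] := hW i x; rewrite subr_ge0 h2/= lerBlDr lerDl.
- by move=> i; rewrite ExB ?Ex_cst ?hmu//; exact: bmeas_cst.
- by apply: (indep_family_comp P M W (fun y => c - y)) => //; exact: measurable_funB.
Qed.

(** * Clipped networks as functions of their parameters: Lipschitz bound and measurability *)

Section Network.
Context {R : realType}.
Implicit Types (lay : nat -> nat) (x : seq R).

Lemma nth_affine dd (th : 'rV[R]_dd) k r s x i : (i < r)%N ->
  nth 0 (affine th k r s x) i =
  \sum_(j < s) pget th (k + i * s + j.+1) * nth 0 x j + pget th (k + r * s + i.+1).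
Proof. by move=> ir; rewrite (nth_map 0%N) ?size_iota// nth_iota. Qed.

Lemma size_affine dd (th : 'rV[R]_dd) k r s x : size (affine th k r s x) = r.
Proof. by rewrite size_map size_iota. Qed.

Lemma nth_relu x i : nth 0 (relu x) i = Num.max (nth 0 x i) 0.
Proof.
have [ix|xi] := ltnP i (size x); first by rewrite (nth_map 0).
by rewrite !nth_default ?size_map// maxxx.
Qed.

Lemma nth_coords d (x : 'rV[R]_d) j (jd : (j < d)%N) :
  nth 0 [seq x ord0 i | i <- enum 'I_d] j = x ord0 (Ordinal jd).
Proof.
rewrite (nth_map (Ordinal jd)) ?size_enum_ord//; congr (x _ _).
by apply/val_inj; rewrite /= nth_enum_ord.
Qed.

Lemma network1E d dd (th : 'rV[R]_dd) l lay (u v : R) (x : 'rV[R]_d) : lay l = 1%N ->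
  network1 th l lay u v x = Num.max u (Num.min (nth 0 (affine th (sparam lay l.-1) (lay l)
    (lay l.-1) (hidden th lay l.-1 [seq x ord0 i | i <- enum 'I_d])) 0) v).
Proof. by move=> l1; rewrite /network1 /network /clip (nth_map 0)// size_affine l1. Qed.

Lemma network1_itv d dd (th : 'rV[R]_dd) l lay (u v : R) (x : 'rV[R]_d) : lay l = 1%N ->
  u <= v -> u <= network1 th l lay u v x <= v.
Proof. by move=> l1 uv; rewrite network1E// le_max lexx/= ge_max uv ge_min lexx orbT. Qed.

Lemma pget_ord dd (th : 'rV[R]_dd) n :
  (exists i, pget th n = th ord0 i) \/ pget th n = 0.
Proof. by rewrite /pget; case: insubP => [i _ _|_]; [left; exists i|right]. Qed.

(** Out of range [pget] is 0, so entrywise bounds pass to it with no condition on the index. *)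
Lemma pget_le dd (th : 'rV[R]_dd) (C : R) n : 0 <= C ->
  (forall i, `|th ord0 i| <= C) -> `|pget th n| <= C.
Proof. by move=> C0 h; case: (pget_ord _ th n) => [[i ->//]| ->]; rewrite normr0. Qed.

Lemma pgetB_le dd (th th' : 'rV[R]_dd) (C : R) n : 0 <= C ->
  (forall i, `|th ord0 i - th' ord0 i| <= C) -> `|pget th n - pget th' n| <= C.
Proof. by move=> C0 h; rewrite /pget; case: insubP => [i _ _|_]; rewrite ?subrr ?normr0. Qed.

Lemma max_dist (u a b : R) : `|Num.max u a - Num.max u b| <= `|a - b|.
Proof. by case: (leP u a) => ?; case: (leP u b) => ?; rewrite ler_norml;
  case: (ger0P (a - b)) => ?; apply/andP; split; lra. Qed.

Lemma min_dist (v a b : R) : `|Num.min a v - Num.min b v| <= `|a - b|.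
Proof. by case: (leP a v) => ?; case: (leP b v) => ?; rewrite ler_norml;
  case: (ger0P (a - b)) => ?; apply/andP; split; lra. Qed.

Lemma relu_dist (a b : R) : `|Num.max a 0 - Num.max b 0| <= `|a - b|.
Proof. by rewrite ![Num.max _ 0]maxC max_dist. Qed.

Lemma clip_dist (u v a b : R) :
  `|Num.max u (Num.min a v) - Num.max u (Num.min b v)| <= `|a - b|.
Proof. exact: le_trans (max_dist _ _ _) (min_dist _ _ _). Qed.

Section Lipschitz.
Variables (dd l : nat) (lay : nat -> nat) (w : nat) (Rb e : R) (th th' : 'rV[R]_dd).
Hypotheses (hw : forall i, (i <= l)%N -> (lay i <= w)%N) (hR : 1 <= Rb) (he : 0 <= e).
Hypotheses (hth : forall i, `|th ord0 i| <= Rb) (hth' : forall i, `|th' ord0 i| <= Rb).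
Hypothesis (hd : forall i, `|th ord0 i - th' ord0 i| <= e).

Let R0 : 0 <= Rb. Proof. exact: le_trans hR. Qed.
Let c : R := w%:R + 1.
Let c1 : 1 <= c. Proof. by rewrite lerDr. Qed.

Let bound k : 1 <= c ^+ k * Rb ^+ k.+1.
Proof. by rewrite mulr_ege1 ?exprn_ege1. Qed.

(** A neuron adds at most w products, each at most Rb times the input bound, and a bias. The input
    bound is at least 1, so the bias counts as one more product: a layer costs the factor c Rb with
    c = w + 1. *)
Lemma affine_bound (t : 'rV[R]_dd) k n x i : (k < l)%N -> (forall i, `|t ord0 i| <= Rb) ->
  (forall j, `|nth 0 x j| <= c ^+ k * Rb ^+ k.+1) ->
  `|nth 0 (affine t n (lay k.+1) (lay k) x) i| <= c ^+ k.+1 * Rb ^+ k.+2.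
Proof.
move=> kl ht hx.
have [ir|ri] := ltnP i (lay k.+1); last first.
  by rewrite nth_default ?size_affine// normr0 (le_trans ler01)// bound.
rewrite nth_affine//.
have -> : c ^+ k.+1 * Rb ^+ k.+2 = w%:R * (Rb * (c ^+ k * Rb ^+ k.+1)) + Rb * (c ^+ k * Rb ^+ k.+1).
  by rewrite /c !exprS; ring.
rewrite (le_trans (ler_normD _ _))// lerD//; last first.
  rewrite (le_trans (pget_le _ _ _ _ R0 ht))// ler_peMr// bound.
rewrite (le_trans (ler_norm_sum _ _ _))//.
apply: (@le_trans _ _ (\sum_(j < lay k) Rb * (c ^+ k * Rb ^+ k.+1))).
  by apply: ler_sum => j _; rewrite normrM ler_pM// pget_le.
rewrite sumr_const card_ord -[leLHS]mulr_natl ler_wpM2r ?ler_nat ?hw 1?ltnW//.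
by rewrite mulr_ge0// (le_trans ler01)// bound.
Qed.

(** From p y - p' y' = (p - p') y + p' (y - y'): the first term contributes e c^k Rb^(k+1), the
    second k times that, so each product moves by at most [B]. The k + 1 here becomes the factor l
    of the Lipschitz constant. *)
Lemma affine_dist k n x x' i : (k < l)%N ->
  (forall j, `|nth 0 x j| <= c ^+ k * Rb ^+ k.+1) ->
  (forall j, `|nth 0 x j - nth 0 x' j| <= k%:R * c ^+ k * Rb ^+ k * e) ->
  `|nth 0 (affine th n (lay k.+1) (lay k) x) i - nth 0 (affine th' n (lay k.+1) (lay k) x') i|
  <= k.+1%:R * c ^+ k.+1 * Rb ^+ k.+1 * e.
Proof.
move=> kl hx hxx'.
have rhs0 m : 0 <= m%:R * c ^+ m * Rb ^+ m * e.
  by rewrite !mulr_ge0 ?exprn_ge0// (le_trans ler01).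
have [ir|ri] := ltnP i (lay k.+1); last first.
  by rewrite !nth_default ?size_affine// subrr normr0.
rewrite !nth_affine// opprD addrACA -sumrB.
pose B := k.+1%:R * c ^+ k * Rb ^+ k.+1 * e.
have -> : k.+1%:R * c ^+ k.+1 * Rb ^+ k.+1 * e = w%:R * B + B.
  by rewrite /B /c !exprS; ring.
have eB : e <= B.
  rewrite /B ler_peMl// -mulrA mulr_ege1 ?bound// ler1n//.
rewrite (le_trans (ler_normD _ _))// lerD//; last exact: le_trans (pgetB_le _ _ _ _ _ he hd) eB.
rewrite (le_trans (ler_norm_sum _ _ _))//.
apply: (@le_trans _ _ (\sum_(j < lay k) B)); last first.
  rewrite sumr_const card_ord -[leLHS]mulr_natl ler_wpM2r ?ler_nat ?hw 1?ltnW//.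
  exact: le_trans eB.
apply: ler_sum => j _.
set p := pget th _; set p' := pget th' _.
have -> : p * nth 0 x j - p' * nth 0 x' j = (p - p') * nth 0 x j + p' * (nth 0 x j - nth 0 x' j).
  by ring.
have -> : B = e * (c ^+ k * Rb ^+ k.+1) + Rb * (k%:R * c ^+ k * Rb ^+ k * e).
  by rewrite /B -natr1 exprS; ring.
rewrite (le_trans (ler_normD _ _))// lerD// normrM ler_pM//; first exact: pgetB_le.
exact: pget_le.
Qed.

(** Size and distance go through one induction because a change of a weight is multiplied by the
    size of the layer's input. Only the size of the [th] side enters. *)
Lemma hidden_lipschitz k x : (k < l)%N -> (forall j, `|nth 0 x j| <= Rb) -> forall j,
  `|nth 0 (hidden th lay k x) j| <= c ^+ k * Rb ^+ k.+1 /\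
  `|nth 0 (hidden th lay k x) j - nth 0 (hidden th' lay k x) j| <= k%:R * c ^+ k * Rb ^+ k * e.
Proof.
move=> + hx; elim: k => [_ j|k ih kl j]; first by rewrite !mul0r subrr normr0 expr0 mul1r expr1.
have {}ih := ih (ltnW kl).
rewrite /= !nth_relu; split; last first.
  apply: le_trans (relu_dist _ _) _; apply: affine_dist; [exact: ltnW| |] => j'; by case: (ih j').
apply: (@le_trans _ _ `|nth 0 (affine th (sparam lay k) (lay k.+1) (lay k) (hidden th lay k x)) j|).
  by set y := nth _ _ _; case: (leP y 0) => ?; rewrite ?normr0.
by apply: affine_bound => //; [exact: ltnW|move=> j'; case: (ih j')].
Qed.

Lemma network1_lipschitz d (u v : R) (x : 'rV[R]_d) : (0 < l)%N -> lay l = 1%N ->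
  (forall i, `|x ord0 i| <= Rb) ->
  `|network1 th l lay u v x - network1 th' l lay u v x| <= l%:R * c ^+ l * Rb ^+ l * e.
Proof.
move=> l0 l1 hx; rewrite !network1E// (le_trans (clip_dist _ _ _ _))//.
have hx' j : `|nth 0 [seq x ord0 i | i <- enum 'I_d] j| <= Rb.
  have [jd|dj] := ltnP j d; last by rewrite nth_default ?normr0// size_map size_enum_ord.
  by rewrite (nth_map (Ordinal jd)) ?size_enum_ord.
have E : l.-1.+1 = l by rewrite prednK.
have ll : (l.-1 < l)%N by rewrite E.
have hh := hidden_lipschitz _ _ ll hx'.
have := affine_dist _ (sparam lay l.-1) _ _ 0 ll (fun j => (hh j).1) (fun j => (hh j).2).
by rewrite E.
Qed.

End Lipschitz.

Section Measurability.
Context {dT : measure_display} {T : measurableType dT}.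

Lemma measurable_affine dd (th : T -> 'rV[R]_dd) (x : T -> seq R) n r s i :
  (forall j, measurable_fun setT (fun t => th t ord0 j)) ->
  (forall j, measurable_fun setT (fun t => nth 0 (x t) j)) ->
  measurable_fun setT (fun t => nth 0 (affine (th t) n r s (x t)) i).
Proof.
move=> mth mx.
have mp m : measurable_fun setT (fun t => pget (th t) m).
  by rewrite /pget; case: insubP.
have [ir|ri] := ltnP i r; last first.
  by rewrite (_ : (fun t => _) = fun=> 0)//; apply/funext => t; rewrite nth_default ?size_affine.
under eq_fun do rewrite nth_affine//.
by apply: measurable_funD => //; apply: measurable_sum => j; exact: measurable_funM.
Qed.

Lemma measurable_hidden dd (th : T -> 'rV[R]_dd) lay (x : T -> seq R) k i :
  (forall j, measurable_fun setT (fun t => th t ord0 j)) ->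
  (forall j, measurable_fun setT (fun t => nth 0 (x t) j)) ->
  measurable_fun setT (fun t => nth 0 (hidden (th t) lay k (x t)) i).
Proof.
move=> mth mx; elim: k i => // k ih i /=; under eq_fun do rewrite nth_relu.
by apply: measurable_maxr => //; exact: measurable_affine.
Qed.

(** Jointly in parameters and input: the selected parameter vector is random, and the risk of a
    random parameter is a partial integral over a product space. *)
Lemma measurable_network1 d dd (th : T -> 'rV[R]_dd) l lay (u v : R) (x : T -> 'rV[R]_d) :
  lay l = 1%N ->
  (forall j, measurable_fun setT (fun t => th t ord0 j)) ->
  (forall j, measurable_fun setT (fun t => x t ord0 j)) ->
  measurable_fun setT (fun t => network1 (th t) l lay u v (x t)).
Proof.
move=> l1 mth mx; under eq_fun do rewrite network1E//.
apply: measurable_maxr => //; apply: measurable_minr => //; apply: measurable_affine => // i.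
apply: measurable_hidden => // j.
have [jd|dj] := ltnP j d; last first.
  rewrite (_ : (fun t => _) = fun=> 0)//; apply/funext => t.
  by apply: nth_default; rewrite size_map size_enum_ord.
rewrite (_ : (fun t => _) = fun t => x t ord0 (Ordinal jd))//; apply/funext => t.
exact: nth_coords.
Qed.

End Measurability.
End Network.

(** * Parameter vectors with prescribed weights and biases *)

Section Realization.
Context {R : realType}.

Lemma sparamS lay k : sparam lay k.+1 = (sparam lay k + lay k.+1 * (lay k + 1))%N.
Proof. by rewrite /sparam big_nat_recr. Qed.

Lemma sparam_mono lay k n : (k <= n)%N -> (sparam lay k <= sparam lay n)%N.
Proof.
elim: n => [|n ih]; first by rewrite leqn0 => /eqP ->.
rewrite leq_eqVlt ltnS => /predU1P[-> //|/ih h].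
by rewrite sparamS (leq_trans h)// leq_addr.
Qed.

Variables (W : nat -> nat -> nat -> R) (b : nat -> nat -> R) (lay : nat -> nat).

(** The block of layer k + 1 in the order in which [affine] reads it: weight matrix row by row, then
    biases. *)
Definition layer_params k : seq R :=
  mkseq (fun q => if (q < lay k.+1 * lay k)%N then W k.+1 (q %/ lay k)%N (q %% lay k)%N
                  else b k.+1 (q - lay k.+1 * lay k)%N) (lay k.+1 * (lay k + 1))%N.

Fixpoint params k : seq R := if k is k'.+1 then params k' ++ layer_params k' else [::].

Lemma size_params k : size (params k) = sparam lay k.
Proof.
elim: k => [|k ih]; first by rewrite /sparam big_geq.
by rewrite /= size_cat ih size_mkseq sparamS.
Qed.

Lemma nth_params l k q : (k < l)%N -> (q < lay k.+1 * (lay k + 1))%N ->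
  nth 0 (params l) (sparam lay k + q) = nth 0 (layer_params k) q.
Proof.
elim: l => // l ih; rewrite ltnS leq_eqVlt => /predU1P[-> q1|kl q1].
  by rewrite /= nth_cat size_params -ltn_subRL subnn ltn0 addKn.
rewrite /= nth_cat size_params ifT ?ih//.
by apply: leq_trans (sparam_mono _ _ _ kl); rewrite sparamS ltn_add2l.
Qed.

(** The witness is [params l] padded with zeros up to length dd. The conclusion holds for all layers
    and all inputs at once, so a network can be designed from its tables [W] and [b]. *)
Lemma realize dd l (C : R) : (sparam lay l <= dd)%N -> 0 <= C ->
  (forall k i j, `|W k i j| <= C) -> (forall k i, `|b k i| <= C) ->
  exists th : 'rV[R]_dd, (forall i, `|th ord0 i| <= C) /\
    forall k i x, (k < l)%N -> (i < lay k.+1)%N ->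
      nth 0 (affine th (sparam lay k) (lay k.+1) (lay k) x) i =
      \sum_(j < lay k) W k.+1 i j * nth 0 x j + b k.+1 i.
Proof.
move=> hdd C0 hW hb.
exists (\row_(i < dd) nth 0 (params l) i); split.
  move=> i; rewrite mxE.
  elim: l {hdd} => [|l ih]; first by rewrite nth_nil normr0.
  rewrite /= nth_cat; case: ifP => // _.
  set n := (_ - _)%N; have [nl|ln] := ltnP n (size (layer_params l)); last first.
    by rewrite nth_default// normr0.
  by move: nl; rewrite size_mkseq => nl; rewrite nth_mkseq//; case: ifP.
move=> k i x kl il; rewrite nth_affine//.
(* [pget] counts from 1: position q + 1 past [sparam lay k] is entry q of the block. *)
have pgetE q : (q < lay k.+1 * (lay k + 1))%N ->
    pget (\row_(i < dd) nth 0 (params l) i) (sparam lay k + q.+1) = nth 0 (layer_params k) q.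
  move=> hq; rewrite /pget addnS /=.
  have hlt : (sparam lay k + q < dd)%N.
    apply: leq_trans hdd; apply: leq_trans (sparam_mono _ _ _ kl).
    by rewrite sparamS ltn_add2l.
  by rewrite insubT mxE/= nth_params.
congr (_ + _).
  apply: eq_bigr => j _; congr (_ * _).
  have hq : (i * lay k + j < lay k.+1 * lay k)%N.
    apply: (@leq_trans (i.+1 * lay k)); last by rewrite leq_mul2r il orbT.
    by rewrite mulSn addnC ltn_add2r ltn_ord.
  have hq' : (i * lay k + j < lay k.+1 * (lay k + 1))%N.
    by apply: leq_trans hq _; rewrite leq_mul2l leq_addr orbT.
  rewrite -addnA (addnS (i * lay k)) pgetE// nth_mkseq// hq.
  have a0 : (0 < lay k)%N by apply: leq_ltn_trans (ltn_ord j).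
  by rewrite divnMDl// modnMDl divn_small// addn0 modn_small.
have hq : (lay k.+1 * lay k + i < lay k.+1 * (lay k + 1))%N.
  by rewrite mulnDr muln1 ltn_add2l.
rewrite -addnA (addnS (lay k.+1 * lay k)) pgetE// nth_mkseq// ltnNge leq_addr/=.
by rewrite addKn.
Qed.

End Realization.

(** * A ReLU network for a maximum of finitely many cones x |-> f k - L |x - a k|_1 *)

Section MaxNetwork.
Context {R : realType}.

Lemma sum_pick n a (y : nat -> R) : (a < n)%N -> \sum_(j < n) (nat_of_ord j == a)%:R * y j = y a.
Proof.
move=> an; rewrite (bigD1 (Ordinal an))//= eqxx mul1r big1 ?addr0// => j ja.
by rewrite (_ : (_ == a) = false) ?mul0r//; apply: contraNF ja => /eqP ja; apply/eqP/val_inj.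
Qed.

(** A block of s = 2 d neurons of the first layer belongs to one centre [a k]; its total is the
    distance to that centre. *)
Lemma sum_block (n s k : nat) (y : nat -> R) : ((k.+1 * s) <= n)%N -> (0 < s)%N ->
  \sum_(j < n) (if (j %/ s)%N == k then 1 else 0) * y j = \sum_(e < s) y (k * s + e)%N.
Proof.
move=> kn s0.
have ks : (k * s <= k.+1 * s)%N by rewrite leq_mul2r leqnSn orbT.
rewrite -(big_mkord xpredT (fun j => (if (j %/ s)%N == k then 1 else 0) * y j)).
rewrite (big_cat_nat (leq0n (k * s)) (leq_trans ks kn))/=.
rewrite (big_cat_nat ks kn)/=.
rewrite [X in X + _]big_nat big1 ?add0r; last first.
  by move=> j /andP[_ jk]; rewrite ifF ?mul0r//; apply/ltn_eqF; rewrite ltn_divLR.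
rewrite [X in _ + X]big_nat [X in _ + X]big1 ?addr0; last first.
  by move=> j /andP[kj _]; rewrite ifF ?mul0r//; apply/gtn_eqF; rewrite leq_divRL.
rewrite -{1}[(k * s)%N]add0n big_addn mulSn addnK big_mkord.
apply: eq_bigr => e _.
by rewrite addnC divnMDl// divn_small// addn0 eqxx mul1r.
Qed.

(** The upper index is included: the maximum of N pieces is [maxupto h N.-1]. *)
Fixpoint maxupto (h : nat -> R) n := if n is n'.+1 then Num.max (maxupto h n') (h n) else h 0%N.

Lemma le_maxupto h n k : (k <= n)%N -> h k <= maxupto h n.
Proof.
elim: n => [|n ih]; first by rewrite leqn0 => /eqP ->.
rewrite leq_eqVlt ltnS => /predU1P[->|/ih hk] /=; rewrite le_max ?lexx ?orbT//.
by rewrite hk.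
Qed.

Lemma maxupto_le h n C : (forall k, (k <= n)%N -> h k <= C) -> maxupto h n <= C.
Proof.
elim: n => [|n ih] H /=; first exact: H.
by rewrite ge_max H// ih// => k kn; apply: H; exact: leqW.
Qed.

Variables (N d l : nat) (lay : nat -> nat) (a : nat -> 'rV[R]_d) (f : nat -> R) (L Rb : R).
Hypotheses (hd : (0 < d)%N) (hN : (2 <= N)%N) (hl : (N < l)%N).
Hypotheses (hl0 : lay 0%N = d) (hl1 : (2 * d * N <= lay 1%N)%N).
Hypothesis (hli : forall i, (2 <= i <= N)%N -> (2 * N - 2 * i + 3 <= lay i)%N).
Hypothesis (hlj : forall j, (N <= j < l)%N -> (2 <= lay j)%N).
Hypotheses (hR : 1 <= Rb) (hL0 : 0 <= L) (hL : L <= Rb).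
Hypotheses (ha : forall k i, `|a k ord0 i| <= Rb) (hf : forall k, `|f k| <= Rb).
Hypothesis (hf01 : `|f 0%N - f 1%N| <= Rb).

(* Coefficients of the affine forms of the layer-[i] outputs that give, respectively,
   the maximum of the first [i] affine pieces and the [k]-th affine piece. *)
Definition hcoef i k j : R :=
  if (i <= 1)%N then (if (j %/ (2 * d))%N == k then - L else 0)
  else (j == (2 * (k - i) + 3)%N)%:R - (j == (2 * (k - i) + 4)%N)%:R.
Definition hbias i k : R := if (i <= 1)%N then f k else 0.
Definition mcoef i j : R :=
  if (i <= 1)%N then hcoef 1 0 j
  else (j == 0)%N%:R + if (i <= N)%N then (j == 1)%N%:R - (j == 2)%N%:R else - (j == 1)%N%:R.
Definition mbias i : R := if (i <= 1)%N then f 0%N else 0.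

Definition acoord k e : R := nth 0 [seq a k ord0 i | i <- enum 'I_d] e.

(** Layout of the neurons, together with the biases [mxb]. In layer 1, block k computes relu(x_e -
    a_k,e) and relu(a_k,e - x_e) for e < d. In layer i + 1 <= N, neuron 0 computes relu(m - h_i),
    with m the maximum of the first i pieces, and neurons 2 j + 1 and 2 j + 2 compute relu(h_(i+j))
    and relu(-h_(i+j)). Later hidden layers keep relu(m) and relu(-m). With N - i pieces left this
    takes 2 (N - i) + 1 = 2 N - 2 (i + 1) + 3 neurons, the width required of the architecture. *)
Definition mxW k q j : R :=
  match k with
  | 0 => 0
  | 1 => let e := (q %% (2 * d))%N in
         if (e < d)%N then (j == e)%:R else - (j == (e - d)%N)%:R
  | i.+1 => if (i.+1 <= N)%N then
      if q == 0%N then mcoef i j - hcoef i i j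
      else if odd q then hcoef i (i + q.-1./2)%N j else - hcoef i (i + q.-1./2)%N j
    else if q == 0%N then mcoef i j else if q == 1%N then - mcoef i j else 0
  end.

Definition mxb k q : R :=
  match k with
  | 0 => 0
  | 1 => let e := (q %% (2 * d))%N in
         if (e < d)%N then - acoord (q %/ (2 * d)) e else acoord (q %/ (2 * d)) (e - d)
  | i.+1 => if (i.+1 <= N)%N then
      if q == 0%N then mbias i - hbias i i
      else if odd q then hbias i (i + q.-1./2)%N else - hbias i (i + q.-1./2)%N
    else if q == 0%N then mbias i else if q == 1%N then - mbias i else 0
  end.

Let R0 : 0 <= Rb. Proof. exact: le_trans hR. Qed.

Lemma acoord_le k e : `|acoord k e| <= Rb.
Proof.
rewrite /acoord; have [ed|de] := ltnP e d; first by rewrite nth_coords.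
by rewrite nth_default ?normr0// size_map size_enum_ord.
Qed.

Lemma hcoef_le i k j : `|hcoef i k j| <= Rb.
Proof.
rewrite /hcoef; case: ifP => _.
  by case: ifP => _; rewrite ?normr0// normrN ger0_norm.
apply: le_trans hR; case: eqVneq => [->|_]; case: eqVneq => [|_];
  by rewrite ?subr0 ?sub0r ?subrr ?normrN ?normr0 ?normr1.
Qed.

Lemma mcoef_le i j : `|mcoef i j| <= Rb.
Proof.
rewrite /mcoef; case: ifP => _; first exact: hcoef_le.
apply: le_trans hR.
by case: j => [|[|[|j]]]; case: ifP => _ /=; rewrite ?(addr0,add0r,subr0,sub0r,oppr0,normrN,normr0,normr1).
Qed.

Lemma hbias_le i k : `|hbias i k| <= Rb.
Proof. by rewrite /hbias; case: ifP => // _; rewrite normr0. Qed.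

Lemma mbias_le i : `|mbias i| <= Rb.
Proof. by rewrite /mbias; case: ifP => // _; rewrite normr0. Qed.

Lemma mxW_le k q j : `|mxW k q j| <= Rb.
Proof.
case: k => [|[|k]] /=; first by rewrite normr0.
  by apply: le_trans hR; case: ifP => _; case: eqP => _; rewrite ?normrN ?normr0 ?normr1.
case: ifP => _; last first.
  case: ifP => _; first exact: mcoef_le.
  by case: ifP => _; rewrite ?normr0// normrN mcoef_le.
case: ifP => _; last by case: ifP => _; rewrite ?normrN hcoef_le.
(* Row 0 is a difference of two forms, and the bound survives because their supports are disjoint:
   blocks 0 and 1 of the first layer here, neurons 0 to 2 against 3 and 4 afterwards. *)
case: k => [|k]; rewrite /mcoef /hcoef /=.
  by case: ifP => _; case: ifP => _; rewrite ?(opprK,addNr,subr0,add0r,oppr0,normrN,normr0)// ger0_norm.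
rewrite subnn muln0 !add0n; apply: le_trans hR.
case: j => [|[|[|[|[|j]]]]]; case: ifP => _ /=;
 by rewrite ?(addr0,add0r,subr0,sub0r,oppr0,opprK,opprB,normrN,normr0,normr1).
Qed.

(** The only bias that combines two values is f 0 - f 1, in row 0 of layer 2; it accounts for the
    factor 2 in R >= 2 sup |phi|. *)
Lemma mxb_le k q : `|mxb k q| <= Rb.
Proof.
case: k => [|[|k]] /=; first by rewrite normr0.
  by case: ifP => _; rewrite ?normrN acoord_le.
case: ifP => _; last first.
  case: ifP => _; first exact: mbias_le.
  by case: ifP => _; rewrite ?normr0// normrN mbias_le.
case: ifP => _; last by case: ifP => _; rewrite ?normrN hbias_le.
by case: k => [|k]; rewrite /mbias /hbias //= subrr normr0.
Qed.

Variable (x : 'rV[R]_d).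
Let h k := f k - L * l1dist x (a k).

(** The induction invariant over the layers. From layer N on, [minn i N] freezes the maximum and the
    second clause is vacuous. *)
Definition layer_inv i (y : seq R) :=
  \sum_(j < lay i) mcoef i j * nth 0 y j + mbias i = maxupto h (minn i N).-1 /\
  forall k, (i <= k < N)%N -> \sum_(j < lay i) hcoef i k j * nth 0 y j + hbias i k = h k.

Let xs := [seq x ord0 i | i <- enum 'I_d].

(** |t| = relu(t) + relu(-t), summed over the block of centre k. The maximum of the first piece is
    that piece, so both clauses are instances of [H]. *)
Lemma layer_inv1 y :
  (forall q, (q < lay 1)%N -> nth 0 y q =
     Num.max (\sum_(j < lay 0) mxW 1 q j * nth 0 xs j + mxb 1 q) 0) ->
  layer_inv 1 y.
Proof.
move=> hy.
have s0 : (0 < 2 * d)%N by rewrite muln_gt0.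
suff H k : (k < N)%N -> \sum_(j < lay 1) hcoef 1 k j * nth 0 y j + f k = h k.
  split; last by move=> k /andP[_ kN]; exact: H.
  have -> : (minn 1 N).-1 = 0%N by rewrite (minn_idPl _)// ltnW.
  by apply: H; apply: leq_trans hN.
move=> kN.
have blk : (k.+1 * (2 * d) <= lay 1)%N.
  by apply: leq_trans hl1; rewrite mulnC leq_mul2l kN orbT.
have -> : \sum_(j < lay 1) hcoef 1 k j * nth 0 y j
    = - L * \sum_(j < lay 1) (if (j %/ (2 * d))%N == k then 1 else 0) * nth 0 y j.
  rewrite mulr_sumr; apply: eq_bigr => j _; rewrite /hcoef /= mulrA; congr (_ * _).
  by case: ifP => _; rewrite ?mulr1 ?mulr0.
rewrite (sum_block _ _ _ (nth 0 y))// /h addrC mulNr; congr (_ - L * _).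
(* Neuron e of the block is paired with neuron d + e: the positive and negative parts of the same
   coordinate difference. *)
have -> : \sum_(e < 2 * d) nth 0 y (k * (2 * d) + e) =
   \sum_(e < d) (nth 0 y (k * (2 * d) + e) + nth 0 y (k * (2 * d) + (d + e))).
  rewrite big_split/= -(big_mkord xpredT (fun e => nth 0 y (k * (2 * d) + e))) /=.
  have d2 : (d <= 2 * d)%N by rewrite leq_pmull.
  rewrite (big_cat_nat (leq0n d) d2)/= big_mkord; congr (_ + _).
  rewrite -{1}[d]add0n big_addn mul2n -addnn addnK big_mkord.
  by apply: eq_bigr => e _; rewrite (addnC d e).
apply: eq_bigr => e _.
have he : (e < 2 * d)%N by rewrite (leq_trans (ltn_ord e))// leq_pmull.
have he' : (d + e < 2 * d)%N by rewrite mul2n -addnn ltn_add2l.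
rewrite !hy; last 2 first.
- by rewrite (leq_trans _ blk)// mulSn addnC ltn_add2r.
- by rewrite (leq_trans _ blk)// mulSn addnC ltn_add2r.
rewrite /= !divnMDl// !modnMDl !(modn_small, divn_small)// ltn_ord addn0.
rewrite ltnNge leq_addr/= addKn.
have xsE : nth 0 xs e = x ord0 e by rewrite nth_coords; congr (x _ _); exact/val_inj.
have asE : acoord k e = a k ord0 e.
  by rewrite /acoord nth_coords; congr (a _ _ _); exact/val_inj.
rewrite (sum_pick _ _ (nth 0 xs)) ?hl0//.
under eq_bigr do rewrite mulNr.
rewrite sumrN (sum_pick _ _ (nth 0 xs))// xsE asE.
by case: (leP (x ord0 e - _)) => ?; case: (leP (- x ord0 e + _)) => ?;
  case: ger0P => ?; lra.
Qed.

Let row i y q := \sum_(j < lay i) mxW i.+1 q j * nth 0 y j + mxb i.+1 q.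

(** Once all pieces are absorbed the maximum is only transported, by m = relu(m) - relu(-m). Row 0
    also serves as the output neuron. *)
Lemma layer_row_tail i q y : (N <= i)%N -> layer_inv i y ->
  row i y q = if q == 0%N then maxupto h N.-1 else if q == 1%N then - maxupto h N.-1 else 0.
Proof.
move=> Ni [hm _]; rewrite (minn_idPr Ni) in hm; rewrite /row.
have i0 : (0 < i)%N by rewrite (leq_trans _ Ni)// ltnW.
case: i i0 Ni hm => // i _ Ni hm /=; rewrite ltnNge Ni/=.
case: ifP => _; first exact: hm.
case: ifP => _; last by rewrite big1 ?addr0// => j _; rewrite mul0r.
by under eq_bigr do rewrite mulNr; rewrite sumrN -opprD hm.
Qed.

Lemma layer_row0 i y : (1 <= i)%N -> (i < N)%N -> layer_inv i y ->
  row i y 0 = maxupto h i.-1 - h i.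
Proof.
case: i => // i _ iN [hm hh]; rewrite (minn_idPl (ltnW iN))/= in hm.
rewrite /row /= iN; under eq_bigr do rewrite mulrBl.
by rewrite sumrB addrACA -opprD hm hh// leqnn.
Qed.

Lemma layer_rowS i q y : (1 <= i)%N -> (i < N)%N -> layer_inv i y -> (0 < q)%N ->
  (i + q.-1./2 < N)%N ->
  row i y q = if odd q then h (i + q.-1./2) else - h (i + q.-1./2).
Proof.
case: i => // i _ iN [_ hh]; case: q => // q _ qN.
have {}hh := hh (i.+1 + q.+1.-1./2)%N; rewrite leq_addr qN in hh.
rewrite /row /mxW /mxb iN /=; case: ifP => _; first exact: hh.
by under eq_bigr do rewrite mulNr; rewrite sumrN -opprD hh.
Qed.

(** For i < N by max(m, h) = relu(m - h) + relu(h) - relu(-h), the later pieces being transported as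
    relu(h) - relu(-h); for i >= N only m is transported. *)
Lemma layer_invS i y y' : (1 <= i)%N -> (i.+1 < l)%N -> layer_inv i y ->
  (forall q, (q < lay i.+1)%N -> nth 0 y' q =
     Num.max (row i y q) 0) ->
  layer_inv i.+1 y'.
Proof.
move=> i1 il inv hy'.
have iS : (i.+1 <= 1)%N = false by rewrite ltnNge i1.
case: (leqP i.+1 N) => iN; last first.
  have l2 : (2 <= lay i.+1)%N by rewrite hlj// il andbT ltnW.
  split; last by move=> k /andP[ik kN]; have := leq_trans (leq_ltn_trans ik kN) (ltnW iN); rewrite ltnn.
  rewrite (minn_idPr (ltnW iN)) /mcoef /mbias iS leqNgt iN/= addr0.
  under eq_bigr do rewrite mulrBl.
  rewrite sumrB !(sum_pick _ _ (nth 0 y'))//; last exact: ltnW.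
  rewrite !hy'//; last exact: ltnW.
  rewrite !(layer_row_tail _ _ _ _ inv)//=.
  by case: (leP (maxupto h N.-1)) => ?; case: (leP (- maxupto h N.-1)) => ?; lra.
have wid : (2 * N - 2 * i.+1 + 3 <= lay i.+1)%N by rewrite hli// iN andbT.
split.
  rewrite (minn_idPl iN) /mcoef /mbias iS iN addr0.
  under eq_bigr do rewrite mulrDl mulrBl.
  have l3 : (3 <= lay i.+1)%N by apply: leq_trans wid; rewrite leq_addl.
  rewrite big_split/= sumrB !(sum_pick _ _ (nth 0 y'))//; [|exact: ltnW|exact: ltnW (ltnW _)].
  rewrite !hy'//; [|exact: ltnW|exact: ltnW (ltnW _)].
  rewrite layer_row0// !layer_rowS ?addn0//=.
  case: i i1 {inv wid l3 hy' il iS iN} => // i _ /=.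
  by case: (leP (maxupto h i)) => ?; case: (leP (maxupto h i - _)) => ?;
    case: (leP (h i.+1)) => ?; case: (leP (- h i.+1)) => ?; lra.
move=> k /andP[ik kN]; rewrite /hcoef /hbias iS addr0.
have e3 : (2 * (k - i.+1) + 3 = (k - i).*2.+1)%N by lia.
have e4 : (2 * (k - i.+1) + 4 = (k - i).*2.+2)%N by lia.
(* For k = N - 1 the larger of the two indices is 2 N - 2 i, the last neuron that the width bound
   guarantees. *)
have w3 : ((k - i).*2.+1 < lay i.+1)%N by lia.
have w4 : ((k - i).*2.+2 < lay i.+1)%N by lia.
rewrite e3 e4; under eq_bigr do rewrite mulrBl.
rewrite sumrB !(sum_pick _ _ (nth 0 y'))// !hy'//.
rewrite !layer_rowS//= ?odd_double/= ?uphalf_double ?doubleK subnKC ?(ltnW ik)//.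
by case: (leP (h k)) => ?; case: (leP (- h k)) => ?; lra.
Qed.

End MaxNetwork.

Lemma max_network {R : realType} (N d dd l : nat) (lay : nat -> nat) (a : nat -> 'rV[R]_d)
  (f : nat -> R) (L Rb u v : R) :
  (0 < d)%N -> (2 <= N)%N -> (N < l)%N -> lay 0%N = d -> (2 * d * N <= lay 1%N)%N ->
  (forall i, (2 <= i <= N)%N -> (2 * N - 2 * i + 3 <= lay i)%N) ->
  (forall j, (N <= j < l)%N -> (2 <= lay j)%N) -> lay l = 1%N -> (sparam lay l <= dd)%N ->
  1 <= Rb -> 0 <= L -> L <= Rb -> (forall k i, `|a k ord0 i| <= Rb) ->
  (forall k, `|f k| <= Rb) -> `|f 0%N - f 1%N| <= Rb ->
  exists th : 'rV[R]_dd, (forall i, `|th ord0 i| <= Rb) /\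
    forall x, network1 th l lay u v x =
      Num.max u (Num.min (maxupto (fun k => f k - L * l1dist x (a k)) N.-1) v).
Proof.
move=> hd hN hl hl0 hl1 hli hlj hll hdd hR hL0 hL ha hf hf01.
have R0 : 0 <= Rb by exact: le_trans hR.
have [th [thR thE]] := realize (mxW N d L) (mxb N d a f) lay dd l Rb hdd R0
  (mxW_le N d L Rb hR hL0 hL) (mxb_le N d a f Rb hR ha hf hf01).
exists th; split => // x; rewrite network1E//; congr (Num.max _ (Num.min _ _)).
set xs := [seq _ | _ <- _].
have inv i : (1 <= i)%N -> (i < l)%N -> layer_inv N d lay a f L x i (hidden th lay i xs).
  elim: i => // i ih _ il; have [i0|i0] := posnP i.
    rewrite i0; apply: layer_inv1 => // q q1; rewrite [hidden _ _ _ _]/= nth_relu thE//.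
    by apply: leq_trans il; rewrite i0.
  apply: (layer_invS N d l lay a f L Rb) (ih i0 (ltnW il)) _ => //.
  by move=> q q1; rewrite [hidden _ _ _ _]/= nth_relu thE// ltnW.
have l0 : (0 < l)%N by exact: leq_ltn_trans hl.
have E : l.-1.+1 = l by rewrite prednK.
have Nl : (N <= l.-1)%N by rewrite -ltnS E.
(* The output layer has no ReLU, so its single neuron is row 0 itself, after layer l - 1 >= N. *)
have := thE l.-1 0%N (hidden th lay l.-1 xs).
rewrite E hll => -> //.
have := layer_row_tail N d lay a f L hN x l.-1 0 (hidden th lay l.-1 xs) Nl.
rewrite E/=; apply => //; apply: inv; last by rewrite E.
by apply: leq_trans Nl; exact: ltnW.
Qed.

(** * Compact sets of row vectors: nets, Borel measurability, Lipschitz envelopes *)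

Section CompactRowVectors.
Context {R : realType}.

Lemma rV_hausdorff d : hausdorff_space 'rV[R]_d.
Proof.
rewrite ball_hausdorff => x y xy.
have [i hi] : exists i, x ord0 i != y ord0 i.
  apply/existsP; rewrite -negb_forall; apply: contra xy => /forallP h.
  by apply/eqP/rowP => i; apply/eqP.
have r0 : 0 < `|x ord0 i - y ord0 i| / 2 by rewrite divr_gt0// normr_gt0 subr_eq0.
exists (PosNum r0, PosNum r0); apply/eqP/seteqP; split => // z [/= [_ h1] [_ h2]].
have := h1 ord0 i; have := h2 ord0 i; rewrite /ball/= => h3 h4.
have : `|x ord0 i - y ord0 i| < `|x ord0 i - y ord0 i|.
  rewrite {2}(splitr `|x ord0 i - y ord0 i|).
  have -> : x ord0 i - y ord0 i = (x ord0 i - z ord0 i) - (y ord0 i - z ord0 i) by ring.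
  by rewrite (le_lt_trans (ler_normB _ _))// ltrD//; move: h3 h4; rewrite !opprB !addrA !subrK.
by rewrite ltxx.
Qed.

Lemma compact_net d (D : set 'rV[R]_d) (e : R) : compact D -> 0 < e ->
  exists A : seq 'rV[R]_d, (forall a, a \in A -> D a) /\
    forall x, D x -> exists2 a, a \in A & forall i, `|x ord0 i - a ord0 i| <= e.
Proof.
rewrite compact_cover => cD e0.
have [|x Dx|A AD cA] := cD _ D (fun a => (ball a e)^°).
- by move=> a _; exact: open_interior.
- by exists x => //; apply: nbhsx_ballx.
exists (finmap.enum_fset A); split; first by move=> a /AD /set_mem.
move=> x /cA[a /= aA] /interior_subset[_ h]; exists a => // i.
by rewrite distrC ltW//; exact: h.
Qed.

(** The net as a sequence, repeating a point of D past its end, in the form that [maxupto] takes. *)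
Lemma compact_net_fun d (D : set 'rV[R]_d) (e : R) : compact D -> D !=set0 -> 0 < e ->
  exists (a : nat -> 'rV[R]_d) (n : nat), (forall k, D (a k)) /\
    forall x, D x -> exists2 k, (k <= n)%N & forall i, `|x ord0 i - a k ord0 i| <= e.
Proof.
move=> cD [x0 Dx0] e0; have [A [AD hA]] := compact_net _ _ _ cD e0.
exists (nth x0 A), (size A); split.
  move=> k; have [kA|Ak] := ltnP k (size A); first exact/AD/mem_nth.
  by rewrite nth_default.
move=> x /hA[a aA h]; exists (index a A); first by rewrite ltnW// index_mem.
by move=> i; rewrite nth_index.
Qed.

Lemma l1dist_le d (x y : 'rV[R]_d) (e : R) : (forall i, `|x ord0 i - y ord0 i| <= e) ->
  l1dist x y <= d%:R * e.
Proof.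
move=> h; apply: (le_trans (ler_sum _ (fun i _ => h i))).
by rewrite sumr_const card_ord mulr_natl.
Qed.

Lemma l1distC d (x y : 'rV[R]_d) : l1dist x y = l1dist y x.
Proof. by apply: eq_bigr => i _; rewrite distrC. Qed.

Lemma l1dist_ge0 d (x y : 'rV[R]_d) : 0 <= l1dist x y.
Proof. by apply: sumr_ge0. Qed.

Lemma maxnorm_ge d (x : 'rV[R]_d) i : `|x ord0 i| <= maxnorm x.
Proof. by rewrite /maxnorm (bigD1 i)//= le_max lexx. Qed.

(** A real [sup] is an upper bound only for sets that are bounded above; a finite net of radius 1
    gives such a bound. *)
Lemma compact_maxnorm d (D : set 'rV[R]_d) z : compact D -> D z ->
  maxnorm z <= sup [set maxnorm z | z in D].
Proof.
move=> cD Dz; apply: ub_le_sup; last by exists z.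
have [A [AD hA]] := compact_net _ _ _ cD ltr01.
exists (\sum_(a <- A) maxnorm a + 1) => _ [x /hA[a aA h] <-].
have m0 (y : 'rV[R]_d) : 0 <= maxnorm y by apply: bigmax_ge_id.
rewrite {1}/maxnorm; apply: bigmax_le => [|i _]; first by rewrite addr_ge0// sumr_ge0.
rewrite -(subrK (a ord0 i) (x ord0 i)) (le_trans (ler_normD _ _))// addrC lerD//.
rewrite (le_trans (maxnorm_ge _ _ i))// (big_rem a)//= lerDl sumr_ge0//.
Qed.

Lemma t2rvK d (t : d.-tuple R) : rv2t (t2rv t) = t.
Proof. by apply: eq_from_tnth => i; rewrite tnth_mktuple mxE. Qed.

Lemma rv2tK d (x : 'rV[R]_d) : t2rv (rv2t x) = x.
Proof. by apply/rowP => i; rewrite mxE tnth_mktuple. Qed.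

Lemma measurable_coord_ball d (a : 'rV[R]_d) (e : R) :
  measurable [set t : d.-tuple R | forall i, `|tnth t i - a ord0 i| <= e].
Proof.
have -> : [set t : d.-tuple R | forall i, `|tnth t i - a ord0 i| <= e] =
    \bigcap_(i in [set: 'I_d]) [set t | `|tnth t i - a ord0 i| <= e].
  by apply/seteqP; split => t /= h i; [move=> _; exact: h|exact: h].
apply: fin_bigcap_measurable => // i _.
have -> : [set t : d.-tuple R | `|tnth t i - a ord0 i| <= e] =
   (fun t : d.-tuple R => tnth t i) @^-1` `[a ord0 i - e, a ord0 i + e].
  by apply/seteqP; split => t /=; rewrite in_itv/= ler_distl.
by rewrite -[_ @^-1` _]setTI; apply: measurable_tnth => //; exact: measurable_itv.
Qed.

(** D is closed, so it is the intersection over n of the finite unions of closed balls of radius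
    1/(n+1) around net points: a point in all of them is a limit of points of D. *)
Lemma compact_borel d (D : set 'rV[R]_d) : compact D -> measurable (@rv2t R d @` D).
Proof.
move=> cD.
have e0 (n : nat) : 0 < n.+1%:R^-1 :> R by rewrite invr_gt0 ltr0n.
have /choice [A hA] n := compact_net _ _ _ cD (e0 n).
have -> : @rv2t R d @` D = \bigcap_n \bigcup_(a in [set` A n])
    [set t | forall i, `|tnth t i - a ord0 i| <= n.+1%:R^-1].
  apply/seteqP; split => t.
    move=> [x Dx <-] n _; have [_ h] := hA n; have [a aA ha] := h x Dx.
    by exists a => //= i; rewrite tnth_mktuple.
  move=> ht; exists (t2rv t); last exact: t2rvK.
  apply: (compact_closed (@rV_hausdorff d) cD) => B /nbhs_ballP[e /= ep eB].
  pose n := Num.truncn (e^-1).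
  have ne : n.+1%:R^-1 < e.
    by rewrite invf_plt ?posrE ?ltr0n// truncnS_gt.
  have [a aA ha] := ht n I; have [AD _] := hA n.
  exists a; split; first exact: AD.
  apply: eB; split=> // i j; rewrite ord1 mxE.
  by apply: le_lt_trans ne; exact: ha.
apply: bigcapT_measurable => n; rewrite bigcup_seq; apply: bigsetU_measurable => a _.
exact: measurable_coord_ball.
Qed.

Lemma measurable_l1dist d (dT : measure_display) (T : measurableType dT)
  (x : T -> 'rV[R]_d) (a : 'rV[R]_d) : (forall i, measurable_fun setT (fun t => x t ord0 i)) ->
  measurable_fun setT (fun t => l1dist (x t) a).
Proof.
move=> mx; apply: measurable_sum => i; apply: measurableT_comp => //.
exact: measurable_funB.
Qed.

Lemma measurable_maxupto (dT : measure_display) (T : measurableType dT) (h : T -> nat -> R) n :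
  (forall k, measurable_fun setT (fun t => h t k)) ->
  measurable_fun setT (fun t => maxupto (h t) n).
Proof. by move=> mh; elim: n => //= n ih; exact: measurable_maxr. Qed.

(** McShane's envelope. By the Lipschitz condition each piece lies below phi; the piece of a centre
    near x loses at most r in the value of phi there and r by its own slope, hence 2 r. *)
Lemma mcshane_dist d (D : set 'rV[R]_d) (phi : 'rV[R]_d -> R) (L r : R) (a : nat -> 'rV[R]_d) n x :
  (forall y z, D y -> D z -> `|phi y - phi z| <= L * l1dist y z) ->
  (forall k, D (a k)) -> D x -> (exists2 k, (k <= n)%N & L * l1dist x (a k) <= r) ->
  phi x - 2 * r <= maxupto (fun k => phi (a k) - L * l1dist x (a k)) n <= phi x.
Proof.
move=> lip Da Dx [k kn hk]; apply/andP; split; last first.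
  apply: maxupto_le => j _; have := lip _ _ (Da j) Dx; rewrite l1distC ler_norml; lra.
apply: le_trans (le_maxupto _ _ _ kn).
by have := lip _ _ (Da k) Dx; rewrite l1distC ler_norml; lra.
Qed.

(** Since phi is constrained on D only, measurability is relative to D: there phi is the pointwise
    limit of envelopes over ever finer nets, each measurable on the whole space. *)
Lemma measurable_lipschitz d (D : set 'rV[R]_d) (phi : 'rV[R]_d -> R) (L : R) :
  compact D -> D !=set0 -> 0 <= L ->
  (forall y z, D y -> D z -> `|phi y - phi z| <= L * l1dist y z) ->
  measurable_fun (@rv2t R d @` D) (phi \o @t2rv R d).
Proof.
move=> cD D0 L0 lip.
have e0 (n : nat) : 0 < n.+1%:R^-1 :> R by rewrite invr_gt0 ltr0n.
have /choice [a /choice [N hA]] n := compact_net_fun _ _ _ cD D0 (e0 n).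
pose F n (t : d.-tuple R) :=
  maxupto (fun k => phi (a n k) - L * l1dist (t2rv t) (a n k)) (N n).
apply: (@measurable_fun_cvg _ _ _ _ F).
  move=> n; apply: measurable_funTS; apply: measurable_maxupto => k.
  apply: measurable_funB => //; apply: measurable_funM => //.
  apply: measurable_l1dist => i; under eq_fun do rewrite mxE; exact: measurable_tnth.
move=> _ [x Dx <-] /=; rewrite rv2tK.
have key n : phi x - (2 * (L * d%:R)) * n.+1%:R^-1 <= F n (rv2t x) <= phi x.
  have [Da hx] := hA n; have [k kn hk] := hx x Dx.
  rewrite -!mulrA /F rv2tK; apply: mcshane_dist lip Da Dx _; exists k => //.
  by rewrite ler_wpM2l// l1dist_le.
apply: (@squeeze_cvgr _ _ _ _ (fun n => phi x - (2 * (L * d%:R)) * n.+1%:R^-1) (cst (phi x))).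
- by near=> n.
- rewrite -[X in _ --> X]subr0; apply: cvgB; first exact: cvg_cst.
  rewrite -(mulr0 (2 * (L * d%:R))); apply: cvgM; first exact: cvg_cst.
  exact: cvg_harmonic.
- exact: cvg_cst.
Unshelve. all: by end_near. Qed.

(** Were there no admissible size up to N, all admissible sizes, and so their infimum, would be at
    least N + 1. *)
Lemma covering_number_points d (D : set 'rV[R]_d) (r : \bar R) (N : nat) : D !=set0 ->
  (covering_number D (@l1dist R d) r <= N%:R%:E)%E ->
  exists a : nat -> 'rV[R]_d, (forall k, D (a k)) /\
    forall x, D x -> exists2 k, (k < N)%N & ((l1dist x (a k))%:E <= r)%E.
Proof.
move=> [x0 Dx0] hN.
have [n [nN [A [An [AD hA]]]]] : exists n, (n <= N)%N /\ exists A : seq 'rV[R]_d,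
    (size A <= n)%N /\ (forall a, a \in A -> D a) /\
    (forall x, D x -> exists a, a \in A /\ ((l1dist a x)%:E <= r)%E).
  apply: contrapT => H.
  have : (N.+1%:R%:E <= covering_number D (@l1dist R d) r)%E.
    apply: le_ereal_inf_tmp => _ [n /= hn <-]; rewrite lee_fin ler_nat ltnNge.
    by apply/negP => nN; apply: H; exists n.
  by move=> /le_trans /(_ hN); rewrite lee_fin ler_nat ltnn.
exists (nth x0 A); split.
  move=> k; have [kA|Ak] := ltnP k (size A); first exact/AD/mem_nth.
  by rewrite nth_default.
move=> x /hA[a [aA h]]; exists (index a A); last by rewrite nth_index// l1distC.
by rewrite (leq_trans _ nN)// (leq_trans _ An)// index_mem.
Qed.

End CompactRowVectors.

(** * Laws and independence of functions of the samples *)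

Section IID.
Context {R : realType} {dT : measure_display} {T : measurableType dT} (P : probability T R).

Lemma rv_measurableP n (Z : T -> 'rV[R]_n) :
  rv_measurable Z <-> forall i, measurable_fun setT (fun w => Z w ord0 i).
Proof.
rewrite /rv_measurable measurable_fun_tnthP; split => h i; have := h i;
  by congr measurable_fun; apply/funext => w /=; rewrite tnth_mktuple.
Qed.

Lemma borel_rV_level n (g : 'rV[R]_n -> R) (B : set R) :
  measurable_fun setT (g \o @t2rv R n) -> measurable B -> borel_rV (g @^-1` B).
Proof.
move=> mg mB; exists ((g \o @t2rv R n) @^-1` B).
  by rewrite -[X in measurable X]setTI; exact: mg.
by apply/seteqP; split => z /=; rewrite rv2tK.
Qed.

Lemma borel_rV_preimage n (Z : T -> 'rV[R]_n) A : rv_measurable Z -> borel_rV A ->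
  measurable (Z @^-1` A).
Proof.
move=> mZ [B mB ->]; rewrite -[X in measurable X]setTI -comp_preimage; exact: mZ.
Qed.

(** Equality of laws on Borel sets says that the pushforwards to tuples coincide, and g is
    integrated against these. *)
Lemma integral_same_law n (Z Z' : T -> 'rV[R]_n) (g : 'rV[R]_n -> R) :
  rv_measurable Z -> rv_measurable Z' ->
  (forall A, borel_rV A -> P (Z @^-1` A) = P (Z' @^-1` A)) ->
  measurable_fun setT (g \o @t2rv R n) -> (forall z, 0 <= g z) ->
  Ex P (g \o Z) = Ex P (g \o Z').
Proof.
move=> mZ mZ' eZ mg g0; rewrite /Ex /Rintegral; congr fine.
have pf (V : T -> 'rV[R]_n) (mV : rv_measurable V) :
    (\int[P]_w ((g \o V) w)%:E = \int[pushforward P (mfun_Sub (mem_set mV))]_t ((g \o @t2rv R n) t)%:E)%E.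
  rewrite ge0_integral_pushforward//.
  - by rewrite preimage_setT; apply: eq_integral => w _ /=; rewrite rv2tK.
  - exact/measurable_EFinP.
  - by move=> t _ /=; rewrite lee_fin g0.
rewrite (pf _ mZ) (pf _ mZ'); apply: eq_measure_integral => A mA _.
rewrite /pushforward/=; have := eZ (@rv2t R n @^-1` A); apply; by exists A.
Qed.

Lemma prod_indic (M : nat) (A : nat -> set T) w :
  \prod_(i < M) \1_(A i) w = \1_(\bigcap_(i in [set i | (i < M)%N]) A i) w :> R.
Proof.
rewrite !indicE; case: (pselect (forall i : 'I_M, A i w)) => h.
  rewrite mem_set; last by move=> i iM; exact: (h (Ordinal iM)).
  by rewrite big1// => i _; rewrite indicE mem_set.
rewrite memNset; last by move=> H; apply: h => i; apply: H => /=.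
have [i hi] : exists i : 'I_M, ~ A i w by apply: contrapT => /forallNP H; apply: h => i; exact: contrapT.
by rewrite (bigD1 i)//= indicE memNset// mul0r.
Qed.

Lemma iid_indep n (M : nat) (Z : nat -> T -> 'rV[R]_n) (g : 'rV[R]_n -> R) (W : nat -> T -> R) :
  iid_family P 1 M Z -> measurable_fun setT (g \o @t2rv R n) ->
  (forall i, (i < M)%N -> W i = g \o Z i.+1) -> indep_family P M W.
Proof.
move=> [mZ _ hI] mg hW B mB.
(* The samples are indexed from 1, the factors of [indep_family] from 0. *)
pose A i := g @^-1` B i.-1.
have bA i : borel_rV (A i) by exact: borel_rV_level.
have mWi i : (i < M)%N -> measurable (W i @^-1` B i).
  by move=> iM; rewrite hW//; apply: (borel_rV_preimage _ (Z i.+1) (A i.+1)) => //; exact: mZ.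
under eq_Ex do rewrite (prod_indic M (fun i => W i @^-1` B i)).
apply: EFin_inj; rewrite Ex_indic; last first.
  apply: fin_bigcap_measurable; first exact: finite_II.
  by move=> i; exact: mWi.
have := hI A bA.
have -> : \bigcap_(i in [set i | (1 <= i <= M)%N]) (Z i @^-1` A i) =
    \bigcap_(i in [set i | (i < M)%N]) (W i @^-1` B i).
  apply/seteqP; split => w /= h i /= hi.
    by rewrite hW//=; exact: (h i.+1 hi).
  by case: i hi => // i hi; have := h i hi; rewrite hW.
move=> ->; rewrite big_add1 big_mkord (big_morph EFin (@EFinM R) erefl).
apply: eq_bigr => i _; rewrite Ex_indic; last exact: mWi.
by rewrite hW.
Qed.

End IID.

Lemma sqr_dist {R : realType} (u v p q y : R) : u <= p <= v -> u <= q <= v -> u <= y <= v ->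
  `|(p - y) ^+ 2 - (q - y) ^+ 2| <= 2 * (v - u) * `|p - q|.
Proof.
move=> /andP[p1 p2] /andP[q1 q2] /andP[y1 y2].
have -> : (p - y) ^+ 2 - (q - y) ^+ 2 = (p + q - 2 * y) * (p - q) by ring.
by rewrite normrM ler_wpM2r// ler_norml; lra.
Qed.

Lemma loss_itv {R : realType} (u v p y : R) : u <= p <= v -> u <= y <= v ->
  0 <= (p - y) ^+ 2 <= (v - u) ^+ 2.
Proof.
move=> /andP[p1 p2] /andP[y1 y2]; rewrite sqr_ge0/= -subr_ge0 subr_sqr.
by rewrite mulr_ge0//; lra.
Qed.

(** * Risk and empirical risk of an abstract parametrized family [net] *)

Section EmpiricalRisk.
Context {R : realType} {dT : measure_display} {Omega : measurableType dT} (P : probability Omega R).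
Variables (d dd M : nat) (u v Lam : R) (D : set 'rV[R]_d) (C : set 'rV[R]_dd).
Variables (X : nat -> Omega -> 'rV[R]_d) (Y : nat -> Omega -> R) (phi : 'rV[R]_d -> R).
Variable net : 'rV[R]_dd -> 'rV[R]_d -> R.
Hypotheses (hM : (0 < M)%N) (huv : u < v).
Hypotheses (mD : measurable (@rv2t R d @` D)) (mphi : measurable_fun (@rv2t R d @` D) (phi \o @t2rv R d)).
Hypothesis (hX : forall m w, (1 <= m <= M)%N -> D (X m w)).
Hypothesis (hY : forall m w, (1 <= m <= M)%N -> u <= Y m w <= v).
Hypothesis (hXY : iid_family P 1 M (fun m w => row_mx (X m w) (Y m w)%:M)).
Hypothesis (hphiD : forall x, D x -> u <= phi x <= v).
Hypothesis (hce : is_cond_exp P (Y 1%N) (X 1%N) phi).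
Hypothesis (net_itv : forall th x, u <= net th x <= v).
Hypothesis (net_meas : forall dT' (T : measurableType dT') (th : T -> 'rV[R]_dd) (x : T -> 'rV[R]_d),
  (forall j, measurable_fun setT (fun t => th t ord0 j)) ->
  (forall j, measurable_fun setT (fun t => x t ord0 j)) ->
  measurable_fun setT (fun t => net (th t) (x t))).
Hypothesis (net_lip : forall th th' (e : R), C th -> C th' -> 0 <= e ->
  (forall i, `|th ord0 i - th' ord0 i| <= e) -> forall x, D x ->
  `|net th x - net th' x| <= Lam * e).

Let h1 : (1 <= 1 <= M)%N. Proof. by rewrite leqnn. Qed.

Definition risk th := Ex P (fun w => (net th (X 1%N w) - phi (X 1%N w)) ^+ 2).
Definition noisy_risk th := Ex P (fun w => (net th (X 1%N w) - Y 1%N w) ^+ 2).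
Definition emp_risk th w := M%:R^-1 * \sum_(1 <= m < M.+1) (net th (X m w) - Y m w) ^+ 2.

Lemma measurable_X m i : (1 <= m <= M)%N -> measurable_fun setT (fun w => X m w ord0 i).
Proof.
move=> hm; have [/(_ m hm)/rv_measurableP h _ _] := hXY.
by have := h (lshift 1 i); congr measurable_fun; apply/funext => w; rewrite row_mxEl.
Qed.

Lemma measurable_Y m : (1 <= m <= M)%N -> measurable_fun setT (Y m).
Proof.
move=> hm; have [/(_ m hm)/rv_measurableP h _ _] := hXY.
by have := h (rshift d ord0); congr measurable_fun; apply/funext => w; rewrite row_mxEr mxE eqxx.
Qed.

Lemma measurable_phiX : measurable_fun setT (phi \o X 1%N).
Proof.
have -> : phi \o X 1%N = (phi \o @t2rv R d) \o (@rv2t R d \o X 1%N).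
  by apply/funext => w /=; rewrite rv2tK.
apply: (measurable_comp mD) mphi _; last first.
  by apply/rv_measurableP => i; exact: measurable_X.
by move=> _ [w _ <-]; exists (X 1%N w) => //; exact: hX.
Qed.

Lemma bmeas_net th m : (1 <= m <= M)%N -> bmeas (fun w => net th (X m w)).
Proof.
move=> hm; apply: (bmeas_itv _ u v) => //; apply: (net_meas _ _ (fun=> th)) => // j.
exact: measurable_X.
Qed.

Lemma bmeas_phiX : bmeas (fun w => phi (X 1%N w)).
Proof. by apply: (bmeas_itv _ u v) => [|w]; [exact: measurable_phiX|exact/hphiD/hX]. Qed.

Lemma bmeas_Y m : (1 <= m <= M)%N -> bmeas (Y m).
Proof. by move=> hm; apply: (bmeas_itv _ u v) => [|w]; [exact: measurable_Y|exact: hY]. Qed.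

(** Expanding the square leaves the cross term E[G H]. Each level set of G is an event {X_1 in A}
    with A Borel, where H integrates to 0 by [hce]; [Ex_orthogonal] concludes. *)
Lemma noisy_riskE th :
  noisy_risk th = risk th + Ex P (fun w => (phi (X 1%N w) - Y 1%N w) ^+ 2).
Proof.
have bn := bmeas_net th 1%N h1; have bp := bmeas_phiX; have bY := bmeas_Y 1%N h1.
pose G w := net th (X 1%N w) - phi (X 1%N w).
pose H w := Y 1%N w - phi (X 1%N w).
have bG : bmeas G by exact: bmeasB.
have bH : bmeas H by exact: bmeasB.
have orth : Ex P (fun w => G w * H w) = 0.
  apply: Ex_orthogonal => // B mB.
  rewrite Ex_setE.
  (* Cutting with D makes A Borel, as phi is known to be measurable only there; X_1 stays in D, so
     the event is unchanged. *)
  pose A := D `&` (fun x => net th x - phi x) @^-1` B.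
  have bA : borel_rV A.
    exists (@rv2t R d @` D `&` (fun t => net th (t2rv t) - phi (t2rv t)) @^-1` B).
      have mf : measurable_fun (@rv2t R d @` D) (fun t => net th (t2rv t) - phi (t2rv t)).
        apply: measurable_funB => //; apply: measurable_funTS.
        apply: (net_meas _ _ (fun=> th) (@t2rv R d)) => // j.
        by under eq_fun do rewrite mxE; exact: measurable_tnth.
      exact: mf.
    apply/seteqP; split => x /=.
      by move=> [Dx Bx]; rewrite rv2tK; split => //; exists x.
    by move=> [[y Dy /(congr1 (@t2rv R d))]]; rewrite !rv2tK => <-.
  have -> : G @^-1` B = X 1%N @^-1` A.
    by apply/seteqP; split => w /= => [Bw|[]//]; split => //; exact: hX.
  have mXA : measurable (X 1%N @^-1` A).
    by apply: borel_rV_preimage => //; apply/rv_measurableP => i; exact: measurable_X.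
  have iS f : bmeas f -> P.-integrable (X 1%N @^-1` A) (EFin \o f).
    by move=> bf; apply: integrableS (bmeas_integrable P f bf).
  rewrite RintegralB//; [|exact: iS|exact: iS].
  by rewrite /Rintegral hce// subrr.
rewrite /noisy_risk /risk.
have -> : Ex P (fun w => (phi (X 1%N w) - Y 1%N w) ^+ 2) = Ex P (fun w => H w ^+ 2).
  by apply: eq_Ex => w; rewrite /H -sqrrN opprB.
rewrite -[RHS]subr0 -(mulr0 2) -orth -ExZ; last exact: bmeasM.
rewrite -ExD; [|exact: bmeas_sqr|exact: bmeas_sqr].
rewrite -ExB; last 2 first.
- by apply: bmeasD; exact: bmeas_sqr.
- by apply: bmeasZ; exact: bmeasM.
by apply: eq_Ex => w; rewrite /G /H; ring.
Qed.

Lemma loss_lip th th' e m w : C th -> C th' -> 0 <= e ->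
  (forall i, `|th ord0 i - th' ord0 i| <= e) -> (1 <= m <= M)%N ->
  `|(net th (X m w) - Y m w) ^+ 2 - (net th' (X m w) - Y m w) ^+ 2| <= 2 * (v - u) * Lam * e.
Proof.
move=> c c' e0 he hm.
apply: le_trans (sqr_dist _ _ _ _ _ (net_itv _ _) (net_itv _ _) (hY _ _ hm)) _.
rewrite -[leRHS]mulrA ler_wpM2l//; first by rewrite mulr_ge0// subr_ge0 ltW.
by apply: net_lip => //; exact: hX.
Qed.

Lemma emp_risk_lip th th' e w : C th -> C th' -> 0 <= e ->
  (forall i, `|th ord0 i - th' ord0 i| <= e) ->
  `|emp_risk th w - emp_risk th' w| <= 2 * (v - u) * Lam * e.
Proof.
move=> c c' e0 he; have M0 : 0 < M%:R :> R by rewrite ltr0n.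
rewrite /emp_risk -mulrBr -sumrB normrM ger0_norm ?invr_ge0 ?ler0n// mulrC ler_pdivrMr//.
rewrite (le_trans (ler_norm_sum _ _ _))//.
apply: (@le_trans _ _ (\sum_(1 <= m < M.+1) (2 * (v - u) * Lam * e))).
  rewrite big_nat [leRHS]big_nat; apply: ler_sum => m hm; exact: loss_lip.
by rewrite sumr_const_nat subSS subn0 mulr_natr.
Qed.

Lemma noisy_risk_lip th th' e : C th -> C th' -> 0 <= e ->
  (forall i, `|th ord0 i - th' ord0 i| <= e) ->
  `|noisy_risk th - noisy_risk th'| <= 2 * (v - u) * Lam * e.
Proof.
move=> c c' e0 he.
have b t : bmeas (fun w => (net t (X 1%N w) - Y 1%N w) ^+ 2).
  by apply: bmeas_sqr; apply: bmeasB; [exact: bmeas_net|exact: bmeas_Y].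
rewrite /noisy_risk -ExB//; apply: Ex_norm_le; first exact: bmeasB.
by move=> w; exact: loss_lip.
Qed.

Lemma measurable_loss th m : (1 <= m <= M)%N ->
  measurable_fun setT (fun w => (net th (X m w) - Y m w) ^+ 2).
Proof.
by move=> hm; apply: measurable_funX; apply: measurable_funB; [case: (bmeas_net th m hm)|exact: measurable_Y].
Qed.

(** Hoeffding with range c = (v - u)^2, that of the squared loss, hence the fourth power. *)
Lemma emp_risk_deviation th eta : 0 < eta ->
  (P [set w | eta <= `|emp_risk th w - noisy_risk th|]%R <=
   (2 * expR (- (2 * eta ^+ 2 * M%:R / (v - u) ^+ 4)))%:E)%E.
Proof.
move=> eta0.
(* Indices beyond the sample are sent to 1, since [hoeffding] wants all [W i] well behaved. *)
pose c i := if (i < M)%N then i.+1 else 1%N.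
have hc i : (1 <= c i <= M)%N by rewrite /c; case: ifP => //; rewrite h1.
pose W i w := (net th (X (c i) w) - Y (c i) w) ^+ 2.
pose g (z : 'rV[R]_(d + 1)) := (net th (lsubmx z) - rsubmx z ord0 ord0) ^+ 2.
have gE m w : g (row_mx (X m w) (Y m w)%:M) = (net th (X m w) - Y m w) ^+ 2.
  by rewrite /g row_mxKl row_mxKr mxE eqxx.
have mg : measurable_fun setT (g \o @t2rv R (d + 1)).
  apply: measurable_funX; apply: measurable_funB.
    apply: (net_meas _ _ (fun=> th) (fun t => lsubmx (t2rv t))) => // j.
    by under eq_fun do rewrite !mxE; exact: measurable_tnth.
  by under eq_fun do rewrite !mxE; exact: measurable_tnth.
have := @hoeffding R dT Omega P M W ((v - u) ^+ 2) (noisy_risk th) eta hM.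
have -> : 2 * eta ^+ 2 * M%:R / (v - u) ^+ 2 ^+ 2 = 2 * eta ^+ 2 * M%:R / (v - u) ^+ 4.
  by rewrite -exprM.
have -> : [set w | eta <= `|M%:R^-1 * \sum_(i < M) W i w - noisy_risk th|]
        = [set w | eta <= `|emp_risk th w - noisy_risk th|].
  apply/seteqP; split => w /=; rewrite /emp_risk big_add1 big_mkord;
    by under eq_bigr do rewrite /W /c ltn_ord.
apply => //.
- by rewrite exprn_gt0// subr_gt0.
- by move=> i; exact: measurable_loss.
- by move=> i w; apply: loss_itv => //; exact: hY.
- move=> i; have [mZ eZ _] := hXY.
  have := @integral_same_law R dT Omega P _ _ _ g (mZ _ (hc i)) (mZ _ h1) _ mg.
  have -> : Ex P (g \o (fun w => row_mx (X (c i) w) (Y (c i) w)%:M)) = Ex P (W i).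
    by apply: eq_Ex => w; rewrite /comp gE.
  have -> : Ex P (g \o (fun w => row_mx (X 1%N w) (Y 1%N w)%:M)) = noisy_risk th.
    by apply: eq_Ex => w; rewrite /comp gE.
  apply; first by move=> A bA; exact: eZ.
  by move=> z; exact: sqr_ge0.
- apply: iid_indep hXY mg _ => i iM; apply/funext => w.
  by rewrite /= gE /W /c iM.
Qed.

Lemma measurable_emp_risk (Th : Omega -> 'rV[R]_dd) : rv_measurable Th ->
  measurable_fun setT (fun w => emp_risk (Th w) w).
Proof.
move=> /rv_measurableP mTh; apply: measurable_funM => //.
rewrite (_ : (fun w => _) = fun w => \sum_(i < M) (net (Th w) (X i.+1 w) - Y i.+1 w) ^+ 2); last first.
  by apply/funext => w; rewrite big_add1 big_mkord.
apply: measurable_sum => i; apply: measurable_funX; apply: measurable_funB.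
  by apply: net_meas => // j; apply: measurable_X; rewrite ltn_ord.
by apply: measurable_Y; rewrite ltn_ord.
Qed.

(** The expectation in [risk] runs over a second copy of Omega, with w entering only through Th w: a
    partial integral in the sense of Tonelli. *)
Lemma measurable_risk (Th : Omega -> 'rV[R]_dd) : rv_measurable Th ->
  measurable_fun setT (fun w => risk (Th w)).
Proof.
move=> /rv_measurableP mTh.
pose f (z : Omega * Omega) := ((net (Th z.1) (X 1%N z.2) - phi (X 1%N z.2)) ^+ 2)%:E.
have mf : measurable_fun setT f.
  apply/measurable_EFinP; apply: measurable_funX; apply: measurable_funB.
    apply: net_meas => j.
      exact: (measurableT_comp (mTh j)).
    exact: (measurableT_comp (measurable_X 1%N j h1)).
  exact: (measurableT_comp measurable_phiX).
have := @measurable_fun_fubini_tonelli_F _ _ _ _ R P f mf.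
move=> /(_ (fun x => _)) h.
apply: (measurableT_comp (fine_measurable measurableT)).
by apply: h => x; rewrite lee_fin sqr_ge0.
Qed.

(** Change of variables; the preimage of D under X_1 is all of Omega. *)
Lemma risk_integralE th :
  (\int[pushforward P (@rv2t R d \o X 1%N)]_(t in @rv2t R d @` D)
     ((net th (t2rv t) - phi (t2rv t)) ^+ 2)%:E = (risk th)%:E)%E.
Proof.
have mX1 : measurable_fun setT (@rv2t R d \o X 1%N).
  by apply/rv_measurableP => i; exact: measurable_X.
rewrite (ge0_integral_pushforward mX1)//; last 2 first.
- apply/measurable_EFinP; apply: measurable_funX; apply: measurable_funB => //.
  apply: measurable_funTS; apply: (net_meas _ _ (fun=> th) (@t2rv R d)) => // j.
  by under eq_fun do rewrite mxE; exact: measurable_tnth.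
- by move=> t _; rewrite lee_fin sqr_ge0.
rewrite /risk ExE; last by apply: bmeas_sqr; apply: bmeasB; [exact: bmeas_net|exact: bmeas_phiX].
have -> : (@rv2t R d \o X 1%N) @^-1` (@rv2t R d @` D) = setT.
  by apply/seteqP; split => // w _; exists (X 1%N w) => //; exact: hX.
by apply: eq_integral => w _ /=; rewrite rv2tK.
Qed.

End EmpiricalRisk.

(** * Random search in the cube, grids, union bound, random selection *)

Section RandomSearch.
Context {R : realType} {dT : measure_display} {T : measurableType dT} (P : probability T R).

Lemma min1X_le (s : R) n : 0 <= s -> Num.min 1 (s ^+ n) <= Num.min s 1 ^+ n.
Proof. by move=> s0; case: (leP s 1) => h; rewrite ge_min ?lexx ?orbT// expr1n lexx. Qed.

(** At an end of [-Rb, Rb] only half of the interval of length 2 r remains, hence r and not 2 r; if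
    r is large the whole cube side remains. *)
Lemma box_side_ge (t r Rb : R) : 0 < r -> 0 < Rb -> `|t| <= Rb ->
  exists2 m : R, Num.min r (2 * Rb) <= m &
    lebesgue_measure (box_side (t - r) (t + r) Rb) = m%:E.
Proof.
move=> r0 R0; rewrite ler_norml => /andP[t1 t2].
pose lo := Num.max (t - r) (- Rb); pose hi := Num.min (t + r) Rb.
have mlh : Num.min r (2 * Rb) <= hi - lo.
  by rewrite /hi /lo; case: (leP r) => ?; case: (leP (t - r)) => ?; case: (leP (t + r)) => ?; lra.
have lh : lo < hi by rewrite -subr_gt0 (lt_le_trans _ mlh)// lt_min r0 mulr_gt0.
exists (hi - lo) => //.
have -> : box_side (t - r) (t + r) Rb = `[lo, hi]%classic.
  apply/seteqP; split => x /=; rewrite /box_side /= !in_itv/= ge_max le_min.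
    by move=> [/andP[-> ->] /andP[-> ->]].
  by move=> /andP[/andP[-> ->] /andP[-> ->]].
by rewrite lebesgue_measure_itv/= lte_fin lh.
Qed.

Definition max_ball n (a : 'rV[R]_n) (r : R) : set 'rV[R]_n :=
  [set z | forall i, `|z ord0 i - a ord0 i| <= r].

Lemma borel_max_ball n (a : 'rV[R]_n) (r : R) : borel_rV (max_ball n a r).
Proof.
exists [set t | forall i, `|tnth t i - a ord0 i| <= r]; first exact: measurable_coord_ball.
by apply/seteqP; split => z /= h i; have := h i; rewrite tnth_mktuple.
Qed.

Lemma borel_setC n (A : set 'rV[R]_n) : borel_rV A -> borel_rV (~` A).
Proof. by move=> [B mB ->]; exists (~` B); [exact: measurableC|rewrite preimage_setC]. Qed.

Lemma uniform_box_ge n (Rb r : R) (Z : T -> 'rV[R]_n) (a : 'rV[R]_n) :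
  0 < r -> 0 < Rb -> (forall i, `|a ord0 i| <= Rb) -> uniform_on_cube P Rb Z ->
  (((Num.min 1 ((r / (2 * Rb)) ^+ n))%:E <=
    P (Z @^-1` max_ball n a r))%E).
Proof.
move=> r0 R0 aR hU.
pose x := \row_(i < n) (a ord0 i - r); pose y := \row_(i < n) (a ord0 i + r).
have -> : max_ball n a r =
    [set z | forall i, x ord0 i <= z ord0 i <= y ord0 i].
  by apply/seteqP; split => z /= h i; have := h i; rewrite !mxE -ler_distl.
rewrite hU.
have /choice [m hm] i : exists m : R, Num.min r (2 * Rb) <= m /\
    lebesgue_measure (box_side (x ord0 i) (y ord0 i) Rb) = m%:E.
  by rewrite !mxE; have [m] := box_side_ge (a ord0 i) r Rb r0 R0 (aR i); exists m.
rewrite (eq_bigr (fun i => (m i / (2 * Rb))%:E)); last first.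
  by move=> i _; have [_ ->] := hm i; rewrite -EFinM.
rewrite -(big_morph EFin (@EFinM R) erefl) lee_fin.
have R2 : 0 < 2 * Rb by rewrite mulr_gt0.
apply: (le_trans (min1X_le _ _ _)); first by rewrite divr_ge0// ltW.
have -> : Num.min (r / (2 * Rb)) 1 ^+ n = \prod_(i < n) Num.min (r / (2 * Rb)) 1.
  by rewrite prodr_const card_ord.
apply: ler_prod => i _; rewrite le_min ler01 divr_ge0 ?(ltW r0) ?(ltW R2)//=.
have [h _] := hm i; rewrite ler_pdivlMr//; apply: le_trans h.
by rewrite minr_pMl ?(ltW R2)// divfK ?gt_eqF// mul1r.
Qed.

(** With p the chance of one hit, independence gives (1 - p)^K, and 1 - p <= exp(-p). *)
Lemma random_search_le n K (Rb r : R) (Z : nat -> T -> 'rV[R]_n) (a : 'rV[R]_n) :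
  (0 < K)%N -> 0 < r -> 0 < Rb -> (forall i, `|a ord0 i| <= Rb) ->
  iid_family P 1 K Z -> uniform_on_cube P Rb (Z 1%N) ->
  (P (\bigcap_(k in [set k | (1 <= k <= K)%N])
       (Z k @^-1` ~` max_ball n a r))
   <= (expR (- K%:R * Num.min 1 ((r / (2 * Rb)) ^+ n)))%:E)%E.
Proof.
move=> K0 r0 R0 aR [mZ eZ hI] hU.
set B := max_ball n a r; have bB : borel_rV B by exact: borel_max_ball.
rewrite (hI (fun=> ~` B)); last by move=> _; exact: borel_setC.
have mB k : (1 <= k <= K)%N -> measurable (Z k @^-1` B).
  by move=> hk; apply: borel_rV_preimage => //; exact: mZ.
have hp := uniform_box_ge _ _ _ _ _ r0 R0 aR hU; rewrite -/B in hp.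
set p := fine (P (Z 1%N @^-1` B)).
have pE k : (1 <= k <= K)%N -> P (Z k @^-1` B) = p%:E.
  by move=> hk; rewrite (eZ k 1%N)// /p fineK//; apply: fin_num_measure; exact: mB.
rewrite big_nat (eq_bigr (fun=> (1 - p)%:E)); last first.
  by move=> k hk; rewrite preimage_setC probability_setC ?pE ?EFinB//; exact: mB.
rewrite -big_nat -(big_morph EFin (@EFinM R) erefl) lee_fin.
rewrite prodr_const_nat subSS subn0.
have p1 : p <= 1 by rewrite -lee_fin -(pE 1%N)//; apply: probability_le1; exact: mB.
apply: (@le_trans _ _ (expR (- p) ^+ K)).
  by rewrite lerXn2r// ?nnegrE ?subr_ge0// ?expR_ge0//; exact: expR_ge1Dx.
rewrite -expRM_natl ler_expR mulNr mulrN lerN2 ler_wpM2l//.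
by rewrite -lee_fin -(pE 1%N).
Qed.

(** The grid points are the midpoints of n equal subintervals of length 2 Rb / n. *)
Lemma grid1 (n : nat) (Rb t : R) : (0 < n)%N -> 0 < Rb -> `|t| <= Rb ->
  exists j : 'I_n, `|t - (- Rb + (2 * j%:R + 1) * (Rb / n%:R))| <= Rb / n%:R.
Proof.
move=> n0 R0; rewrite ler_norml => /andP[t1 t2].
have nR : 0 < n%:R :> R by rewrite ltr0n.
pose s := (t + Rb) / (2 * Rb) * n%:R.
have R2 : 0 < 2 * Rb by rewrite mulr_gt0.
have s0 : 0 <= s by rewrite mulr_ge0// divr_ge0 ?(ltW R2)//; lra.
have sn : s <= n%:R.
  by rewrite /s -[leRHS]mul1r ler_wpM2r// ler_pdivrMr//; lra.
have tE : t = - Rb + 2 * s * (Rb / n%:R).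
  by rewrite /s; field; rewrite !gt_eqF.
have [j [j1 j2]] : exists j : 'I_n, j%:R <= s /\ s <= j%:R + 1.
  have /andP[h1 h2] := truncn_itv s0; set k := Num.truncn s in h1 h2.
  have [kn|nk] := ltnP k n; first by exists (Ordinal kn); rewrite natr1; split => //; exact: ltW.
  (* Here s = n, that is t = Rb, which is assigned to the last subinterval. *)
  have hn : (n.-1 < n)%N by rewrite prednK.
  exists (Ordinal hn) => /=; rewrite natr1 prednK//; split => //.
  by apply: le_trans h1; rewrite ler_nat (leq_trans _ nk)// leq_pred.
exists j; rewrite {1}tE.
have -> : - Rb + 2 * s * (Rb / n%:R) - (- Rb + (2 * j%:R + 1) * (Rb / n%:R)) =
   (2 * s - 2 * j%:R - 1) * (Rb / n%:R) by ring.
have q0 : 0 <= Rb / n%:R by rewrite divr_ge0// ltW.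
rewrite normrM (ger0_norm q0) -[leRHS]mul1r ler_wpM2r// ler_norml; lra.
Qed.

Definition grid_point dd n (Rb : R) (g : {ffun 'I_dd -> 'I_n}) : 'rV[R]_dd :=
  \row_i (- Rb + (2 * (g i)%:R + 1) * (Rb / n%:R)).

Lemma grid_point_cube dd n (Rb : R) (g : {ffun 'I_dd -> 'I_n}) i : (0 < n)%N -> 0 < Rb ->
  `|grid_point dd n Rb g ord0 i| <= Rb.
Proof.
move=> n0 R0; rewrite mxE; have nR : 0 < n%:R :> R by rewrite ltr0n.
have q0 : 0 <= Rb / n%:R by rewrite divr_ge0// ltW.
have gn : (g i)%:R + 1 <= n%:R :> R by rewrite natr1 ler_nat.
have e1 : n%:R * (Rb / n%:R) = Rb by rewrite mulrC divfK ?gt_eqF.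
have := ler_wpM2r q0 gn; rewrite e1 mulrDl mul1r.
have : 0 <= (g i)%:R * (Rb / n%:R) by rewrite mulr_ge0.
by rewrite mulrDl mul1r -mulrA ler_norml; lra.
Qed.

Lemma grid_cover dd n (Rb : R) (th : 'rV[R]_dd) : (0 < n)%N -> 0 < Rb ->
  (forall i, `|th ord0 i| <= Rb) ->
  exists g, forall i, `|th ord0 i - grid_point dd n Rb g ord0 i| <= Rb / n%:R.
Proof.
move=> n0 R0 hth.
have /choice [g hg] i := grid1 n Rb (th ord0 i) n0 R0 (hth i).
by exists (finfun g) => i; rewrite mxE ffunE.
Qed.

Lemma union_bound (I : Type) (s : seq I) (A : I -> set T) : (forall i, measurable (A i)) ->
  (P (\big[setU/set0]_(i <- s) A i) <= \sum_(i <- s) P (A i))%E.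
Proof.
move=> mA; elim: s => [|i s ih]; first by rewrite !big_nil measure0.
rewrite !big_cons; apply: (le_trans (measureU2 _ _ _)) => //.
  exact: bigsetU_measurable.
exact: leeD2l.
Qed.

Lemma measurable_ge_fun (f : T -> R) c : measurable_fun setT f -> measurable [set w | c <= f w].
Proof.
move=> mf; rewrite -[X in measurable X]setTI.
have -> : [set w | c <= f w] = f @^-1` `[c, +oo[.
  by apply/seteqP; split => w /=; rewrite in_itv/= andbT.
by apply: mf => //; exact: measurable_itv.
Qed.

(** Used for a random index: picking the first k that satisfies [b k] is a nest of measurable case
    distinctions along the list. *)
Lemma measurable_select (s : seq nat) (b : nat -> T -> bool) (f : nat -> T -> R) :
  (forall k, measurable_fun setT (b k)) -> (forall k, measurable_fun setT (f k)) ->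
  measurable_fun setT (fun w => f (nth 0%N s (find (fun k => b k w) s)) w).
Proof.
move=> mb mf; elim: s => [|k s ih] //=.
rewrite (_ : (fun w => _) = fun w => if b k w then f k w else f (nth 0%N s (find (fun k => b k w) s)) w).
  exact: measurable_fun_ifT.
by apply/funext => w; case: (b k w).
Qed.

End RandomSearch.

(** * The error bound, given a parameter [ths] that approximates phi *)

Section OverallError.
Context {R : realType} {dT : measure_display} {Omega : measurableType dT} (P : probability Omega R).
Variables (d dd K M : nat) (eps u v Lam Rb : R) (D : set 'rV[R]_d).
Variables (X : nat -> Omega -> 'rV[R]_d) (Y : nat -> Omega -> R) (phi : 'rV[R]_d -> R).
Variable net : 'rV[R]_dd -> 'rV[R]_d -> R.
Variables (Theta : nat -> Omega -> 'rV[R]_dd) (Xi : Omega -> 'rV[R]_dd) (ths : 'rV[R]_dd).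
Let C : set 'rV[R]_dd := [set th | forall i, `|th ord0 i| <= Rb].
Hypotheses (hK : (0 < K)%N) (hM : (0 < M)%N) (heps : 0 < eps) (huv : u < v).
Hypotheses (hLam : 0 < Lam) (hRb : 0 < Rb).
Hypotheses (mD : measurable (@rv2t R d @` D)) (mphi : measurable_fun (@rv2t R d @` D) (phi \o @t2rv R d)).
Hypothesis (hX : forall m w, (1 <= m <= M)%N -> D (X m w)).
Hypothesis (hY : forall m w, (1 <= m <= M)%N -> u <= Y m w <= v).
Hypothesis (hXY : iid_family P 1 M (fun m w => row_mx (X m w) (Y m w)%:M)).
Hypothesis (hphiD : forall x, D x -> u <= phi x <= v).
Hypothesis (hce : is_cond_exp P (Y 1%N) (X 1%N) phi).
Hypothesis (net_itv : forall th x, u <= net th x <= v).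
Hypothesis (net_meas : forall dT' (T : measurableType dT') (th : T -> 'rV[R]_dd) (x : T -> 'rV[R]_d),
  (forall j, measurable_fun setT (fun t => th t ord0 j)) ->
  (forall j, measurable_fun setT (fun t => x t ord0 j)) ->
  measurable_fun setT (fun t => net (th t) (x t))).
Hypothesis (net_lip : forall th th' (e : R), C th -> C th' -> 0 <= e ->
  (forall i, `|th ord0 i - th' ord0 i| <= e) -> forall x, D x ->
  `|net th x - net th' x| <= Lam * e).
Hypotheses (hths : C ths) (hbias : forall x, D x -> `|net ths x - phi x| <= eps / 2).
Hypotheses (hThB : forall k w, (1 <= k <= K)%N -> C (Theta k w)).
Hypotheses (hTh : iid_family P 1 K Theta) (hunif : uniform_on_cube P Rb (Theta 1%N)).
Let Emp := emp_risk d dd M X Y net.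
Let Risk := risk P d dd X phi net.
Let Noisy := noisy_risk P d dd X Y net.
Hypothesis (XiC : forall w, C (Xi w)).
Hypothesis (Ximin : forall w k, (1 <= k <= K)%N -> Emp (Xi w) w <= Emp (Theta k w) w).
Hypothesis (mXi : measurable_fun setT (fun w => Risk (Xi w))).

Let S := v - u.
Let S0 : 0 < S. Proof. by rewrite subr_gt0. Qed.
(** With n > x grid points per axis the mesh satisfies 2 S Lam Rb / n <= eps^2/16. *)
Let x := 32 * S * Lam * Rb / eps ^+ 2.
Let x0 : 0 < x. Proof. by rewrite divr_gt0 ?mulr_gt0 ?exprn_gt0. Qed.
Let n := (Num.truncn x).+1.
Let dev g := [set w | eps ^+ 2 / 8 <= `|Emp (grid_point dd n Rb g) w - Noisy (grid_point dd n Rb g)|]%R.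
(** Solves 2 S Lam r = eps^2/4, the share of the random search. *)
Let r := eps ^+ 2 / (8 * S * Lam).
Let r0 : 0 < r. Proof. by rewrite divr_gt0 ?mulr_gt0 ?exprn_gt0. Qed.

Lemma risk_ths : Risk ths <= eps ^+ 2 / 4.
Proof.
have h1 : (1 <= 1 <= M)%N by rewrite leqnn.
rewrite -[leRHS](Ex_cst P); apply: le_Ex.
- apply: bmeas_sqr; apply: bmeasB.
    exact: (bmeas_net P d dd M u v X Y net hXY net_itv net_meas).
  exact: (bmeas_phiX P d M u v D X Y phi hM mD mphi hX hXY hphiD).
- exact: bmeas_cst.
move=> w; have := hbias _ (hX 1%N w h1); rewrite ler_norml => /andP[b1 b2].
by rewrite -subr_ge0 (_ : _ - _ = (eps / 2 - (net ths (X 1%N w) - phi (X 1%N w))) *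
  (eps / 2 + (net ths (X 1%N w) - phi (X 1%N w)))); [rewrite mulr_ge0//; lra|field].
Qed.

Lemma good_event w : (exists2 k, (1 <= k <= K)%N & max_ball dd ths r (Theta k w)) ->
  (forall g, ~ dev g w) -> Risk (Xi w) <= eps ^+ 2.
Proof.
move=> [k hk hbox] hdev.
have nR : 0 < n%:R :> R by rewrite ltr0n.
(* At most [eps^2/8] deviation at the nearest grid point, plus twice a Lipschitz slack of
   [eps^2/16] for moving there. *)
have close th : C th -> `|Emp th w - Noisy th| <= eps ^+ 2 / 4.
  move=> cth; have [g hg] := grid_cover dd n Rb th isT hRb cth.
  set c := grid_point dd n Rb g in hg.
  have cc : C c by move=> i; exact: grid_point_cube.
  have q0 : 0 <= Rb / n%:R by rewrite divr_ge0// ltW.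
  have l1 : `|Emp th w - Emp c w| <= 2 * (v - u) * Lam * (Rb / n%:R).
    exact: (emp_risk_lip d dd M u v Lam D C X Y net).
  have l2 : `|Noisy th - Noisy c| <= 2 * (v - u) * Lam * (Rb / n%:R).
    exact: (noisy_risk_lip P d dd M u v Lam D C X Y net).
  have l3 : `|Emp c w - Noisy c| < eps ^+ 2 / 8.
    by rewrite ltNge; apply/negP; exact: hdev g.
  have slack : 2 * (v - u) * Lam * (Rb / n%:R) <= eps ^+ 2 / 16.
    have xn : x <= n%:R by rewrite ltW// truncnS_gt.
    have e0 : 0 < eps ^+ 2 by rewrite exprn_gt0.
    rewrite /x ler_pdivrMr// in xn.
    rewrite mulrA ler_pdivrMr// -/S; lra.
  move: l1 l2 l3; rewrite !ler_norml ltr_norml; lra.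
have hmin := Ximin w k hk.
have e4 : 2 * (v - u) * Lam * r = eps ^+ 2 / 4.
  by rewrite /r -/S; field; rewrite !gt_eqF.
have hk' : `|Emp (Theta k w) w - Emp ths w| <= 2 * (v - u) * Lam * r.
  by apply: (emp_risk_lip d dd M u v Lam D C X Y net) => //; [exact: hThB|exact: ltW].
have c1 := close _ (XiC w); have c2 := close _ hths.
have nE th : Noisy th = Risk th + Ex P (fun w => (phi (X 1%N w) - Y 1%N w) ^+ 2).
  exact: (noisy_riskE P d dd M u v D X Y phi net).
(* The constant of [noisy_riskE] cancels between Xi and [ths]. [close] is used once at each of them,
   costing eps^2/2; minimality of Xi and [hk'] cost eps^2/4, and [risk_ths] the last eps^2/4. *)
have := risk_ths; move: c1 c2 hk'; rewrite !nE e4 !ler_norml; lra.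
Qed.

(** If x < 1 then n = 1; otherwise n <= x + 1 <= 4 x. *)
Lemma card_grid_le : (n ^ dd)%:R <= expR (dd%:R * ln (Num.max 1 (4 * x))).
Proof.
have m0 : 0 < Num.max 1 (4 * x) by rewrite lt_max ltr01.
rewrite expRM_natl lnK ?posrE// natrX lerXn2r ?nnegrE ?(ltW m0)//.
have /andP[h1 _] := truncn_itv (ltW x0); rewrite le_max; have [x1|x1] := ltP x 1.
  have : (Num.truncn x < 1)%N by rewrite -(ltr_nat R) (le_lt_trans h1).
  by rewrite ltnS leqn0 /n => /eqP ->; rewrite lexx.
by apply/orP; right; rewrite /n -natr1; lra.
Qed.

Lemma overall_error : (P [set w | (eps ^+ 2)%R < Risk (Xi w)]%R <=
  (expR (- K%:R * Num.min 1 (eps ^+ (2 * dd) / (16 * S * Lam * Rb) ^+ dd))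
   + 2 * expR (dd%:R * ln (Num.max 1 (128 * Lam * Rb * S / eps ^+ 2))
               - eps ^+ 4 * M%:R / (32 * S ^+ 4)))%:E)%E.
Proof.
pose bad1 := \bigcap_(k in [set k | (1 <= k <= K)%N]) (Theta k @^-1` ~` max_ball dd ths r).
pose bad2 := \big[setU/set0]_(g : {ffun 'I_dd -> 'I_n}) dev g.
have mdev g : measurable (dev g).
  apply: measurable_ge_fun; apply: measurableT_comp => //; apply: measurable_funB => //.
  apply: (measurable_emp_risk P d dd M X Y net hXY net_meas (fun=> _)).
  by apply/rv_measurableP => i; exact: measurable_cst.
have mbad2 : measurable bad2 by apply: bigsetU_measurable.
have mbad1 : measurable bad1.
  have [mT _ _] := hTh.
  apply: bigcap_measurable => [|k hk]; first by exists 1%N; apply/andP.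
  by apply: borel_rV_preimage; [exact: mT|apply: borel_setC; exact: borel_max_ball].
have sub : [set w | (eps ^+ 2)%R < Risk (Xi w)]%R `<=` bad1 `|` bad2.
  move=> w /= hw; apply: contrapT => /not_orP[nb1 nb2].
  suff : Risk (Xi w) <= eps ^+ 2 by rewrite leNgt hw.
  apply: good_event.
    apply: contrapT => H; apply: nb1 => k hk /= hb; apply: H; by exists k.
  by move=> g hg; apply: nb2; rewrite /bad2 -bigcup_seq/=; exists g => //=; rewrite mem_index_enum.
have mev : measurable [set w | (eps ^+ 2)%R < Risk (Xi w)]%R.
  rewrite -[X in measurable X]setTI.
  have -> : [set w | (eps ^+ 2)%R < Risk (Xi w)]%R = (fun w => Risk (Xi w)) @^-1` `]eps ^+ 2, +oo[.
    by apply/seteqP; split => w /=; rewrite in_itv/= andbT.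
  by apply: mXi => //; exact: measurable_itv.
have le1 : (P [set w | (eps ^+ 2)%R < Risk (Xi w)]%R <= P (bad1 `|` bad2))%E.
  by apply: le_measure sub; rewrite inE//; exact: measurableU.
apply: (le_trans le1); apply: (le_trans (measureU2 _ mbad1 mbad2)); rewrite EFinD; apply: leeD.
  have := random_search_le P dd K Rb r Theta ths hK r0 hRb hths hTh hunif.
  have -> // : (r / (2 * Rb)) ^+ dd = eps ^+ (2 * dd) / (16 * S * Lam * Rb) ^+ dd.
  by rewrite exprM -expr_div_n; congr (_ ^+ _); rewrite /r; field; rewrite !gt_eqF.
apply: (le_trans (union_bound P _ _ _ mdev)).
pose p := 2 * expR (- (eps ^+ 4 * M%:R / (32 * S ^+ 4))).
have devp g : (P (dev g) <= p%:E)%E.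
  have e8 : 0 < eps ^+ 2 / 8 by rewrite divr_gt0// exprn_gt0.
  have := emp_risk_deviation P d dd M u v X Y net hM huv hY hXY net_itv net_meas
    (grid_point dd n Rb g) _ e8.
  have -> // : 2 * (eps ^+ 2 / 8) ^+ 2 * M%:R / (v - u) ^+ 4 = eps ^+ 4 * M%:R / (32 * S ^+ 4).
  by rewrite /S; field; rewrite gt_eqF.
apply: (@le_trans _ _ (\sum_(g : {ffun 'I_dd -> 'I_n}) p%:E)%E).
  by apply: lee_sum => g _.
rewrite sumEFin lee_fin sumr_const card_ffun !card_ord -[leLHS]mulr_natl.
rewrite /p expRD mulrCA ler_wpM2l// ler_wpM2r ?expR_ge0//.
have -> : 128 * Lam * Rb * S / eps ^+ 2 = 4 * x by rewrite /x; field; rewrite gt_eqF.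
exact: card_grid_le.
Qed.

End OverallError.

(** * Approximation of phi by a network, and the selected parameter *)

Lemma bigmine_attained {R : realType} (s : seq nat) (f : nat -> R) : (0 < size s)%N ->
  (exists2 k, k \in s & (\big[mine/+oo]_(j <- s) (f j)%:E = (f k)%:E)%E) /\
  forall j, j \in s -> (\big[mine/+oo]_(j <- s) (f j)%:E <= (f j)%:E)%E.
Proof.
elim: s => // k s ih _; have [s0|/ih [[m ms E] le]] := posnP (size s).
  rewrite (size0nil s0) big_cons big_nil min_l ?leey//.
  by split; [exists k; rewrite ?mem_head|move=> j; rewrite inE => /eqP ->].
rewrite big_cons; set b := (\big[mine/+oo]_(j <- s) _)%E in E le *; split.
  case: (leP (f k)%:E b) => h; first by exists k; rewrite ?mem_head.
  by exists m; rewrite ?inE ?ms ?orbT.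
move=> j; rewrite inE => /predU1P[->|/le h]; first by rewrite ge_min lexx.
by rewrite ge_min h orbT.
Qed.

(** Two distinct points are at positive distance; this rules out a negative L. *)
Lemma lipschitz_const_ge0 {R : realType} d (D : set 'rV[R]_d) (phi : 'rV[R]_d -> R) (L : R) :
  (exists x y, [/\ D x, D y & x <> y]) ->
  (forall x y, D x -> D y -> `|phi x - phi y| <= L * l1dist x y) -> 0 <= L.
Proof.
move=> [x [y [Dx Dy xy]]] lip; have := le_trans (normr_ge0 _) (lip _ _ Dx Dy).
rewrite pmulr_lge0// lt_neqAle l1dist_ge0 andbT eq_sym.
apply/eqP => h; apply: xy; apply/rowP => i; apply/eqP; rewrite -subr_eq0 -normr_eq0.
by move/eqP: h; rewrite psumr_eq0// => /allP/(_ i); rewrite mem_index_enum; exact.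
Qed.

(** The envelope over a covering with L |x - a_k|_1 <= eps/4 is within 2 eps/4 of phi, and clipping
    to [u, v] does not increase the distance to phi, whose values lie there. *)
Lemma network_approximation {R : realType} (d dd : nat) (eps L u v : R) (D : set 'rV[R]_d)
  (phi : 'rV[R]_d -> R) (N l : nat) (lay : nat -> nat) (Rb : R) :
  (0 < d)%N -> 0 < eps -> D !=set0 -> 0 <= L ->
  (forall x, D x -> u <= phi x <= v) ->
  (forall x y, D x -> D y -> `|phi x - phi y| <= L * l1dist x y) ->
  (maxe 2%:E (covering_number D (@l1dist R d)
     (if L == 0%R then +oo%E else (eps / (4 * L))%:E)) <= (N%:R)%:E)%E ->
  (N < l)%N -> lay 0%N = d -> (2 * d * N <= lay 1%N)%N ->
  (forall i, (2 <= i <= N)%N -> (2 * N - 2 * i + 3 <= lay i)%N) ->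
  (forall j, (N <= j < l)%N -> (2 <= lay j)%N) -> lay l = 1%N -> (sparam lay l <= dd)%N ->
  1 <= Rb -> L <= Rb -> (forall x i, D x -> `|x ord0 i| <= Rb) ->
  (forall x, D x -> 2 * `|phi x| <= Rb) ->
  exists th : 'rV[R]_dd, (forall i, `|th ord0 i| <= Rb) /\
    forall x, D x -> `|network1 th l lay u v x - phi x| <= eps / 2.
Proof.
move=> hd heps D0 L0 hphiD lip; rewrite ge_max => /andP[hN2 hcov].
move=> hl hl0 hl1 hli hlj hll hsum hR1 hRL hxR hphiR.
have N2 : (2 <= N)%N by move: hN2; rewrite lee_fin ler_nat.
have [a [Da ha]] := covering_number_points _ _ _ _ D0 hcov.
have fR k : 2 * `|phi (a k)| <= Rb by apply: hphiR.
have [| |th [thR thE]] := max_network N d dd l lay a (phi \o a) L Rb u v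
  hd N2 hl hl0 hl1 hli hlj hll hsum hR1 L0 hRL (fun k i => hxR _ i (Da k)).
- by move=> k /=; have := fR k; have := normr_ge0 (phi (a k)); lra.
- by rewrite (le_trans (ler_normB _ _))//=; have := fR 0%N; have := fR 1%N; lra.
exists th; split => // x Dx; rewrite thE.
have [k kN hk] := ha x Dx.
(* For L = 0 the radius is +oo and carries no information, but then the product is 0. *)
have hk' : L * l1dist x (a k) <= eps / 4.
  move: hk; case: eqVneq => [-> _|Ln]; first by rewrite mul0r divr_ge0// ltW.
  have Lp : 0 < L by rewrite lt_neqAle eq_sym Ln.
  rewrite lee_fin => /(ler_wpM2l L0) /le_trans; apply.
  by rewrite le_eqVlt; apply/orP; left; apply/eqP; field.
have := mcshane_dist d D phi L (eps / 4) a N.-1 x lip Da Dx.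
have kN1 : (k <= N.-1)%N by rewrite -ltnS prednK// (leq_ltn_trans _ kN).
move=> /(_ (ex_intro2 _ _ k kN1 hk')) /=.
set F := maxupto _ _; have /andP[p1 p2] := hphiD x Dx => /andP[f1 f2].
rewrite ler_norml; case: (leP F v) => h1; case: (leP u) => h2; lra.
Qed.

Theorem theorem4p5
  (R : realType) (dT : measure_display) (Omega : measurableType dT)
  (P : probability Omega R)
  (d dd K M : nat) (hd : (0 < d)%N) (hdd : (0 < dd)%N) (hK : (0 < K)%N)
  (hM : (0 < M)%N)
  (eps L u v : R) (heps : 0 < eps) (huv : u < v)
  (D : set 'rV[R]_d) (hDc : compact D)
  (hD2 : exists x y, [/\ D x, D y & x <> y])
  (X : nat -> Omega -> 'rV[R]_d) (Y : nat -> Omega -> R)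
  (hX : forall m w, (1 <= m <= M)%N -> D (X m w))
  (hY : forall m w, (1 <= m <= M)%N -> u <= Y m w <= v)
  (hXY : iid_family P 1 M (fun m w => row_mx (X m w) (Y m w)%:M))
  (phi : 'rV[R]_d -> R)
  (hphiD : forall x, D x -> u <= phi x <= v)
  (hce : is_cond_exp P (Y 1%N) (X 1%N) phi)
  (hlip : forall x y, D x -> D y -> `|phi x - phi y| <= L * l1dist x y)
  (N : nat) (hN1 : (0 < N)%N)
  (hN : (maxe 2%:E
           (covering_number D (@l1dist R d)
              (if L == 0%R then +oo%E else (eps / (4 * L))%:E))
         <= (N%:R)%:E)%E)
  (l : nat) (hl : (N < l)%N)
  (lay : nat -> nat) (hlay : forall i, (i <= l)%N -> (0 < lay i)%N)
  (hl0 : lay 0%N = d)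
  (hl1 : (2 * d * N <= lay 1%N)%N)
  (hli : forall i, (2 <= i <= N)%N -> (2 * N - 2 * i + 3 <= lay i)%N)
  (hlj : forall j, (N <= j < l)%N -> (2 <= lay j)%N)
  (hll : lay l = 1%N)
  (hsum : (sparam lay l <= dd)%N)
  (Rb : R) (hR1 : 1 <= Rb) (hRL : L <= Rb)
  (hRD : sup [set maxnorm z | z in D] <= Rb)
  (hRphi : 2 * sup [set `|phi z| | z in D] <= Rb)
  (Theta : nat -> Omega -> 'rV[R]_dd)
  (hThB : forall k w i, (1 <= k <= K)%N -> - Rb <= Theta k w ord0 i <= Rb)
  (hTh : iid_family P 1 K Theta)
  (hunif : uniform_on_cube P Rb (Theta 1%N)) :
  let Emp := fun (theta : 'rV[R]_dd) (w : Omega) =>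
    M%:R^-1 * \sum_(1 <= m < M.+1)
      (network1 theta l lay u v (X m w) - Y m w) ^+ 2 in
  let Emin := fun w => (\big[mine/+oo]_(1 <= j < K.+1) (Emp (Theta j w) w)%:E)%E in
  let kstar := fun w => nth 0%N (iota 1 K)
      (find (fun k => (Emp (Theta k w) w)%:E == Emin w) (iota 1 K)) in
  let Xi := fun w => Theta (kstar w) w in
  let lmax := (arch_maxnorm l lay)%:R in
  (P [set w | (\int[pushforward P (@rv2t R d \o X 1%N)]_(t in @rv2t R d @` D)
                 ((network1 (Xi w) l lay u v (t2rv t) - phi (t2rv t)) ^+ 2)%:E
               > (eps ^+ 2)%:E)%E]
   <= (expR (- K%:R * Num.min 1
              (eps ^+ (2 * dd) /
               (16 * (v - u) * l%:R * (lmax + 1) ^+ l * Rb ^+ l.+1) ^+ dd))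
       + 2 * expR (dd%:R * ln (Num.max 1
              (128 * l%:R * (lmax + 1) ^+ l * Rb ^+ l.+1 * (v - u) / eps ^+ 2))
            - eps ^+ 4 * M%:R / (32 * (v - u) ^+ 4)))%:E)%E.
Proof.
cbv zeta.
pose Emp := fun (theta : 'rV[R]_dd) (w : Omega) =>
  M%:R^-1 * \sum_(1 <= m < M.+1) (network1 theta l lay u v (X m w) - Y m w) ^+ 2.
pose Emin := fun w => (\big[mine/+oo]_(1 <= j < K.+1) (Emp (Theta j w) w)%:E)%E.
pose kstar := fun w => nth 0%N (iota 1 K)
  (find (fun k => (Emp (Theta k w) w)%:E == Emin w) (iota 1 K)).
pose Xi := fun w => Theta (kstar w) w.
pose lmax : R := (arch_maxnorm l lay)%:R.
have D0 : D !=set0 by have [x [y [Dx _ _]]] := hD2; exists x.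
have L0 : 0 <= L by exact: lipschitz_const_ge0 hD2 hlip.
have R0 : 0 < Rb by exact: lt_le_trans hR1.
have hxR x i : D x -> `|x ord0 i| <= Rb.
  by move=> Dx; apply: le_trans (maxnorm_ge _ _ i) _; apply: le_trans hRD; exact: compact_maxnorm.
have hphiR x : D x -> 2 * `|phi x| <= Rb.
  move=> Dx; apply: le_trans hRphi; rewrite ler_wpM2l//; apply: ub_le_sup; last by exists x.
  exists (`|u| + `|v|) => _ [y Dy <-]; have /andP[p1 p2] := hphiD y Dy.
  by rewrite ler_norml; have := ler_norm v; have := ler_norm (- u); rewrite normrN;
    have := normr_ge0 u; have := normr_ge0 v; lra.
have l0 : (0 < l)%N by exact: leq_ltn_trans hl.
have [ths [thsR hths]] := network_approximation d dd eps L u v D phi N l lay Rb hd heps D0 L0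
  hphiD hlip hN hl hl0 hl1 hli hlj hll hsum hR1 hRL hxR hphiR.
pose net (th : 'rV[R]_dd) (x : 'rV[R]_d) := network1 th l lay u v x.
pose Lam := l%:R * (lmax + 1) ^+ l * Rb ^+ l.
have lmax0 : 0 <= lmax by exact: ler0n.
have Lam0 : 0 < Lam by rewrite !mulr_gt0 ?exprn_gt0 ?ltr0n// ltr_wpDl.
have mD := compact_borel _ _ hDc.
have mphi := measurable_lipschitz _ _ _ _ hDc D0 L0 hlip.
have net_itv th x : u <= net th x <= v by apply: network1_itv => //; exact: ltW.
have net_meas dT' (T : measurableType dT') (th : T -> 'rV[R]_dd) (x : T -> 'rV[R]_d) :
    (forall j, measurable_fun setT (fun t => th t ord0 j)) ->
    (forall j, measurable_fun setT (fun t => x t ord0 j)) ->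
    measurable_fun setT (fun t => net (th t) (x t)).
  by move=> mth mx; exact: measurable_network1.
pose C : set 'rV[R]_dd := [set th | forall i, `|th ord0 i| <= Rb].
have net_lip (th th' : 'rV[R]_dd) (e : R) : C th -> C th' -> 0 <= e ->
    (forall i, `|th ord0 i - th' ord0 i| <= e) -> forall x, D x ->
    `|net th x - net th' x| <= Lam * e.
  move=> c c' e0 he x Dx; rewrite /net /Lam.
  apply: (network1_lipschitz dd l lay (arch_maxnorm l lay)) => // [i il|i].
    by rewrite /arch_maxnorm (leq_bigmax (F := fun i : 'I_l.+1 => lay i) (Ordinal (il : (i < l.+1)%N))).
  exact: hxR.
have ThC k w : (1 <= k <= K)%N -> C (Theta k w).
  by move=> hk i; rewrite ler_norml; exact: hThB.
have attained w := bigmine_attained (iota 1 K) (fun k => Emp (Theta k w) w).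
have EminE w : Emin w = (\big[mine/+oo]_(j <- iota 1 K) (Emp (Theta j w) w)%:E)%E.
  by rewrite /Emin /index_iota subSS subn0.
have sK : (0 < size (iota 1 K))%N by rewrite size_iota.
have has_star w : has (fun k => (Emp (Theta k w) w)%:E == Emin w) (iota 1 K).
  have [[k ks E] _] := attained w sK; apply/hasP; exists k => //.
  by rewrite EminE E.
have kstar_in w : (1 <= kstar w <= K)%N.
  by rewrite -(mem_iota 1 K) mem_nth// -has_find.
have Ximin w k : (1 <= k <= K)%N -> Emp (Xi w) w <= Emp (Theta k w) w.
  move=> hk; have [_ le] := attained w sK.
  have /eqP := nth_find 0%N (has_star w); rewrite -lee_fin => ->.
  by rewrite EminE le// mem_iota.
have [mTh _ _] := hTh.
have mEmp k : (1 <= k <= K)%N -> measurable_fun setT (fun w => Emp (Theta k w) w).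
  by move=> hk; exact: (measurable_emp_risk P d dd M X Y net hXY net_meas (Theta k) (mTh k hk)).
have mXi : measurable_fun setT (fun w => risk P d dd X phi net (Xi w)).
  have mEmin : measurable_fun setT Emin.
    have -> : Emin = fun w => (\big[mine/+oo]_(j <- iota 1 K) (Emp (Theta j w) w)%:E)%E.
      by apply/funext.
    have : all (fun k => (1 <= k <= K)%N) (iota 1 K) by apply/allP => k; rewrite mem_iota.
    elim: (iota 1 K) => [|k s ih] /=.
      by move=> _; under eq_fun do rewrite big_nil; exact: measurable_cst.
    move=> /andP[hk /ih h]; under eq_fun do rewrite big_cons.
    by apply: measurable_mine => //; apply/measurable_EFinP; exact: mEmp.
  (* [measurable_select] wants measurability for every k, while [Theta k] is controlled only for 1
     <= k <= K; the guards settle the other indices and change nothing on [iota 1 K]. *)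
  pose b k w := (1 <= k <= K)%N && ((Emp (Theta k w) w)%:E == Emin w).
  pose f k w := if (1 <= k <= K)%N then risk P d dd X phi net (Theta k w) else 0.
  have mb k : measurable_fun setT (b k).
    rewrite /b; case hk : (1 <= k <= K)%N => /=; last exact: measurable_cst.
    by apply: measurable_fun_eqe => //; apply/measurable_EFinP; exact: mEmp.
  have mf k : measurable_fun setT (f k).
    rewrite /f; case hk : (1 <= k <= K)%N; last exact: measurable_cst.
    exact: (measurable_risk P d dd M D X Y phi net hM mD mphi hX hXY net_meas (Theta k) (mTh k hk)).
  have := measurable_select (iota 1 K) b f mb mf; congr measurable_fun.
  apply/funext => w; have -> : find (fun k => b k w) (iota 1 K) =
      find (fun k => (Emp (Theta k w) w)%:E == Emin w) (iota 1 K).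
    by apply: eq_in_find => k; rewrite mem_iota /b => ->.
  by rewrite -/(kstar w) /f kstar_in.
have := overall_error P d dd K M eps u v Lam Rb D X Y phi net Theta Xi ths hK hM heps huv
  Lam0 R0 mD mphi hX hY hXY hphiD hce net_itv net_meas net_lip thsR hths ThC hTh hunif
  (fun w => ThC _ w (kstar_in w)) Ximin mXi.
have -> : 16 * (v - u) * Lam * Rb = 16 * (v - u) * l%:R * (lmax + 1) ^+ l * Rb ^+ l.+1.
  by rewrite /Lam exprS; ring.
have -> : 128 * Lam * Rb * (v - u) = 128 * l%:R * (lmax + 1) ^+ l * Rb ^+ l.+1 * (v - u).
  by rewrite /Lam exprS; ring.
apply: le_trans; rewrite le_eqVlt; apply/orP; left; apply/eqP; congr (P _).
apply/seteqP; split => w /=;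
  by rewrite (risk_integralE P d dd M u v D X Y phi net) ?lte_fin.
Qed.
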